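(* Fix integers $1\le k\le M$. For each $N\ge M$ let $(\lambda_i)_{i\in I_k}$ be distributed according to $\mathrm{Gin}(N,M,k)$ (all these point configurations, for varying $N$, being defined on a common probability space), and let $c_k=|I_k|$. Then, as $N\to\infty$, the empirical distribution of $\mathrm{Gin}(N,M,k)$ converges weakly to the $M$-twisted circular law: for any bounded continuous $f:\mathbb{C}\to\mathbb{R}$, $$\frac{1}{c_k}\sum_{i\in I_k}f(\lambda_i)\xrightarrow[N\to\infty]{a.s.}\frac{1}{\pi M}\int_{\mathbb{D}}f(\omega)\,|\omega|^{2/M-2}\,\mathrm{d}m(\omega).$$
   Context: $m$ is Lebesgue measure on $\mathbb{C}$ and $\mathbb{D}$ is the unit disk. For integers $1\le k\le M$ and $N$, $I_k=I_{N,M,k}=\{i\in\{1,\dots,N\}: i\equiv k \pmod M\}$ and $c_k=|I_k|$. The Power-Ginibre distribution $\mathrm{Gin}(N,M,k)$ is the point process of $c_k$ complex points indexed by $I_k$ with joint density, with respect to Lebesgue measure on $\mathbb{C}^{I_k}$, proportional to $\prod_{i<j;\ i,j\in I_k}|z_i-z_j|^2\prod_{i\in I_k}|z_i|^{2(k-M)/M}e^{-N|z_i|^{2/M}}$. The $M$-twisted circular law is the probability measure on $\mathbb{D}$ with density $\frac{1}{\pi M}|\omega|^{2/M-2}$; it is the push-forward of the uniform measure on $\mathbb{D}$ by $z\mapsto z^M$. *)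

(* Defs.v *)
From HB Require Import structures.
From mathcomp Require Import all_boot all_order all_algebra.
From mathcomp Require Import all_classical all_reals all_analysis.
From mathcomp Require Import complex.

Set Implicit Arguments.
Unset Strict Implicit.
Unset Printing Implicit Defensive.

Import Order.TTheory GRing.Theory Num.Theory.
Import numFieldNormedType.Exports.

Local Open Scope classical_set_scope.
Local Open Scope ring_scope.

(* The complex plane is represented by pairs of real numbers (x, y) standing  *)
(* for x + iy, with the library's product topology and product sigma-algebra. *)
(* [measurableTypeR R] is [R] with its Borel sets; it is the type on which    *)
(* [lebesgue_measure] is defined.                                             *)
Notation plane R := (measurableTypeR R * measurableTypeR R)%type.

(* The library's canonical sigma-finite structure on [m1 \x m2] is only found  *)
(* for probability measures.                                                  *)
Lemma product_sigma_finite d1 d2 (T1 : measurableType d1)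
    (T2 : measurableType d2) (R : realType)
    (m1 : {sigma_finite_measure set T1 -> \bar R})
    (m2 : {sigma_finite_measure set T2 -> \bar R}) :
  sigma_finite setT (m1 \x m2)%E.
Proof.
have /sigma_finiteP[F [TF ndF Foo]] := sigma_finiteT m1.
have /sigma_finiteP[G [TG ndG Goo]] := sigma_finiteT m2.
exists (fun n => F n `*` G n).
  rewrite -setXTT TF TG predeqE => -[x y]; split.
    move=> [/= [n _ Fnx] [k _ Gky]]; exists (maxn n k) => //; split.
    - by move: x Fnx; exact/subsetPset/ndF/leq_maxl.
    - by move: y Gky; exact/subsetPset/ndG/leq_maxr.
  by move=> [n _ []/= ? ?]; split; exists n.
move=> k; have [? ?] := Foo k; have [? ?] := Goo k.
split; first exact: measurableX.
by rewrite product_measure1E// lte_mul_pinfty// ge0_fin_numE.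
Qed.

Section plane_lebesgue.
Variable R : realType.

Definition plane_lebesgue : set (plane R) -> \bar R :=
  (@lebesgue_measure R \x @lebesgue_measure R)%E.

HB.instance Definition _ := Measure.copy plane_lebesgue
  ((@lebesgue_measure R \x @lebesgue_measure R)%E : {measure set _ -> \bar R}).

HB.instance Definition _ := Measure_isSigmaFinite.Build _ _ _ plane_lebesgue
  (product_sigma_finite (@lebesgue_measure R) (@lebesgue_measure R)).

End plane_lebesgue.

(* Beware that the library's norm on pairs is the max norm, hence the detour  *)
(* through the complex modulus.                                               *)
Definition modulus (R : realType) (z : plane R) : R :=
  ComplexField.Normc.normc (Complex z.1 z.2).

Definition unit_disk (R : realType) : set (plane R) := [set z | modulus z < 1].

(* n-fold product of a sigma-finite measure, on n.-tuple T                    *)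
Section power_measure.
Context d (T : measurableType d) (R : realType).

Definition cons_pair n (p : T * n.-tuple T) : n.+1.-tuple T :=
  [tuple of p.1 :: p.2].

Lemma measurable_cons_pair n : measurable_fun setT (@cons_pair n).
Proof.
exact: (measurable_cons (@measurable_fst _ _ T (n.-tuple T))
                        (@measurable_snd _ _ T (n.-tuple T))).
Qed.

Section cons_measure.
Variables (n : nat) (mu : {sigma_finite_measure set T -> \bar R}).
Variable nu : {sigma_finite_measure set (n.-tuple T) -> \bar R}.

Definition cons_measure : set (n.+1.-tuple T) -> \bar R :=
  pushforward (mu \x nu)%E (@cons_pair n).

Let cons_measure0 : cons_measure set0 = 0%E.
Proof. by rewrite /cons_measure /pushforward preimage_set0 measure0. Qed.

Let cons_measure_ge0 A : (0 <= cons_measure A)%E.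
Proof. by rewrite /cons_measure /pushforward measure_ge0. Qed.

Let cons_measure_sigma_additive : semi_sigma_additive cons_measure.
Proof.
move=> F mF tF mUF; rewrite /cons_measure /pushforward preimage_bigcup.
apply: measure_semi_sigma_additive.
- by move=> n0; rewrite -[X in measurable X]setTI; exact: measurable_cons_pair.
- apply/trivIsetP => /= i j _ _ ij; rewrite -preimage_setI.
  by move/trivIsetP : tF => /(_ _ _ _ _ ij) ->//; rewrite preimage_set0.
- rewrite -preimage_bigcup -[X in measurable X]setTI.
  exact: measurable_cons_pair.
Qed.

HB.instance Definition _ := isMeasure.Build _ _ _ cons_measure
  cons_measure0 cons_measure_ge0 cons_measure_sigma_additive.

Let cons_measure_sigma_finite : sigma_finite setT cons_measure.
Proof.
have [F FT Foo] := product_sigma_finite mu nu.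
pose g (t : n.+1.-tuple T) : T * n.-tuple T := (thead t, [tuple of behead t]).
have mg : measurable_fun setT g.
  by apply/measurable_fun_pair => //=;
    [exact: measurable_tnth|exact: measurable_behead].
have gK p : g (cons_pair p) = p.
  by case: p => x t; rewrite /g /cons_pair /= theadE; congr (_, _); exact/val_inj.
exists (fun i => g @^-1` F i).
  by rewrite -preimage_bigcup -FT.
move=> i; have [mFi Fi_oo] := Foo i; split.
  by rewrite -[X in measurable X]setTI; exact: mg.
rewrite /cons_measure /pushforward -comp_preimage.
by rewrite (_ : g \o _ = id)//; apply/funext => p; exact: gK.
Qed.

HB.instance Definition _ := Measure_isSigmaFinite.Build _ _ _ cons_measure
  cons_measure_sigma_finite.

End cons_measure.

Fixpoint power_measure (mu : {sigma_finite_measure set T -> \bar R}) n :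
    {sigma_finite_measure set (n.-tuple T) -> \bar R} :=
  match n with
  | 0%N => dirac ([tuple] : 0.-tuple T)
  | n'.+1 => cons_measure mu (power_measure mu n')
  end.

Lemma power_measure_box (mu : {sigma_finite_measure set T -> \bar R}) n
    (A : 'I_n -> set T) : (forall i, measurable (A i)) ->
  (power_measure mu n [set t | forall i, A i (tnth t i)] =
     \prod_(i < n) mu (A i))%E.
Proof.
elim: n A => [|n IHn] A mA.
  by rewrite big_ord0 /= diracE mem_set// => -[].
pose B := [set t : n.-tuple T | forall i, A (lift ord0 i) (tnth t i)].
have mB : measurable B.
  rewrite (_ : B = \bigcap_(i in [set: 'I_n])
      ((fun t : n.-tuple T => tnth t i) @^-1` A (lift ord0 i))).
    apply: fin_bigcap_measurable => [|i _]; first exact: finite_finset.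
    by rewrite -[X in measurable X]setTI; exact: measurable_tnth.
  by apply/seteqP; split=> t /= Bt i; [move=> _|]; exact: Bt.
rewrite big_ord_recl -IHn// -product_measure1E//=.
rewrite /cons_measure /pushforward; congr product_measure1.
apply/seteqP; split=> [[x t] /= At|[x t] [/= Ax Bt] i].
  split; first by have := At ord0; rewrite /= tnth0.
  by move=> i; have := At (lift ord0 i); rewrite tnthS.
by have [j ->|->] := unliftP ord0 i; rewrite ?tnthS ?tnth0.
Qed.

End power_measure.

Section power_ginibre.
Variable R : realType.
Variables N M k : nat.

(* I_k, listed in increasing order *)
Definition gin_index : seq nat := [seq i <- iota 1 N | i == k %[mod M]].

Definition gin_card : nat := size gin_index.

(* Unnormalised joint density. The points indexed by I_k are listed in a      *)
(* tuple, following the increasing enumeration of I_k.                        *)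
Definition gin_weight (z : gin_card.-tuple (plane R)) : R :=
  (\prod_(i < gin_card) \prod_(j < gin_card | (i < j)%N)
     modulus (tnth z i - tnth z j) ^+ 2) *
  \prod_(i < gin_card)
    (modulus (tnth z i) `^ (2 * (k%:R - M%:R) / M%:R) *
     expR (- (N%:R * modulus (tnth z i) `^ (2 / M%:R)))).

(* Q has a density proportional to [gin_weight] with respect to Lebesgue      *)
(* measure on C^{I_k}; if Q has mass 1 this determines Q.                     *)
Definition is_Gin (Q : set (gin_card.-tuple (plane R)) -> \bar R) : Prop :=
  exists2 a : R, 0 < a & forall A, measurable A ->
    Q A = (\int[power_measure (@plane_lebesgue R) gin_card]_(z in A)
             (a * gin_weight z)%:E)%E.

Definition gin_points (Omega : Type) (lambda : nat -> Omega -> plane R)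
    (w : Omega) : gin_card.-tuple (plane R) :=
  map_tuple (fun i => lambda i w) (in_tuple gin_index).

End power_ginibre.

Arguments gin_weight {R} N M k z.
Arguments is_Gin {R} N M k Q.

(* Main.v *)
(** Let c = |I_k|. The joint density is |Vandermonde|^2 times a product of
    rotation-invariant weights, so by Andreief's identity its integral against
    a product h(z_1)...h(z_c) is c! times the determinant of the Gram matrix of
    the monomials 1, z, ..., z^(c-1) for the weight multiplied by h. For h = 1
    this Gram matrix is diagonal, monomials being orthogonal for a
    rotation-invariant weight; for h = exp(s g), Hadamard's inequality bounds
    the determinant by the product of the diagonal entries. Hence
    E exp(s sum_i g(lambda_i)) <= prod_l E_l exp(s g), where E_l is the
    expectation for the normalised weight |z|^(2l) W(z). For bounded g this gives
    exponential concentration of (1/c) sum_i g(lambda_i) around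
    (1/c) sum_l E_l g, and Borel-Cantelli applies whatever the coupling between
    different values of N.

    It remains to find the limit of (1/c) sum_l E_l f. In the coordinate
    x = |z|^(2/M), the l-th weight is the Gamma(k + Ml) density with rate N times
    the weight |z|^(2/M-2) of the twisted circular law, so this mean is the
    integral of f against that weight times q_N(x)/(pi M), with q_N(x) = (N/c) times
    the probability that a Poisson(Nx) variable is k-1 modulo M and less than
    about N. Consecutive Poisson weights differ by at most (Nx)^(-1/2) in total,
    so q_N(x) tends to 1 for 0 < x < 1, and Scheffe's argument upgrades this to
    convergence in L^1 to the indicator of x < 1. *)

Require Import Defs.
From HB Require Import structures.
From mathcomp Require Import all_boot all_order all_fingroup all_algebra.
From mathcomp Require Import all_classical all_reals all_analysis.
From mathcomp Require Import measurable_realfun complex unstable.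
From mathcomp Require Import ring lra zify.

Set Implicit Arguments.
Unset Strict Implicit.
Unset Printing Implicit Defensive.

Import Order.TTheory GRing.Theory Num.Theory.
Import numFieldNormedType.Exports.

Local Open Scope classical_set_scope.
Local Open Scope ring_scope.

(** * Hadamard's inequality *)

(** Hadamard's inequality bounds exponential moments only from above, so lower deviations of [f] are
    treated as upper deviations of [- f]. In E_l exp(s g) the exponential is replaced by its linear
    part plus a quadratic error; choosing s small in terms of the deviation eps and the bound B
    leaves a rate delta independent of N. Since c is at least N/M - 1, the tails are geometric in N.

    Polar coordinates are replaced by scaling. A dilation of the plane multiplies x = |z|^(2/M) by
    some l, and its Jacobian times the twisted weight also gains the factor l. The image of that
    weight under x is therefore homogeneous of degree one, hence a multiple of Lebesgue measure on
    the half-line, and the Gaussian integral identifies the multiple as pi M.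

    In Scheffe's argument the densities q_N and the indicator of x < 1 have the same total mass, so
    their L^1 distance is twice the integral of the positive part of the indicator minus q_N. That
    part is dominated by the indicator, which is integrable, so that pointwise convergence for 0 < x
    < 1 suffices. *)

Section hadamard.
Variable C : numClosedFieldType.

Definition quad_form n (G : 'M[C]_n) (x : 'I_n -> C) : C :=
  \sum_i \sum_j x i * (x j)^* * G i j.

(** In a [numClosedFieldType], [0 <= z] also says that [z] is real. *)
Definition psd_mx n (G : 'M[C]_n) : Prop := forall x, 0 <= quad_form G x.

Definition herm_mx n (G : 'M[C]_n) : Prop := forall i j, G j i = (G i j)^*.

Lemma psd_diag_ge0 n (G : 'M[C]_n) i : psd_mx G -> 0 <= G i i.
Proof.
move=> /(_ (fun j => (j == i)%:R)); rewrite /quad_form (bigD1 i)//=.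
rewrite (bigD1 i)//= eqxx conjC1 !mul1r big1 ?addr0; last first.
  by move=> j /negPf ->; rewrite rmorph0 mulr0 mul0r.
rewrite big1 ?addr0; last first.
  by move=> j /negPf ->; apply: big1 => l _; rewrite !mul0r.
by [].
Qed.

Definition schur n (G : 'M[C]_n.+1) : 'M[C]_n := \matrix_(i, j)
  (G (lift ord0 i) (lift ord0 j) -
   G (lift ord0 i) ord0 * G ord0 (lift ord0 j) / G ord0 ord0).

(** One step of block Gaussian elimination: [G] is a unit lower triangular matrix [L] times a block
    upper triangular [U] whose last block is the Schur complement. *)
Lemma det_schur n (G : 'M[C]_n.+1) : G ord0 ord0 != 0 ->
  \det G = G ord0 ord0 * \det (schur G).
Proof.
move=> a0.
pose L : 'M[C]_(1 + n) := block_mx 1%:M 0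
  (\col_i (G (lift ord0 i) ord0 / G ord0 ord0)) 1%:M.
pose U : 'M[C]_(1 + n) := block_mx (G ord0 ord0)%:M
  (\row_j G ord0 (lift ord0 j)) 0 (schur G).
have GE : G = L *m U :> 'M[C]_(1 + n).
  apply/matrixP => i j; rewrite mulmx_block !mul1mx !mul0mx !addr0 ?mulmx0 ?addr0.
  have E0 m : lshift m (ord0 : 'I_1) = ord0 :> 'I_m.+1 by apply/val_inj.
  case: (split_ordP i) => i' ->; case: (split_ordP j) => j' ->;
    rewrite ?block_mxEul ?block_mxEur ?block_mxEdl ?block_mxEdr
      ?(ord1 i') ?(ord1 j') ?rshift1 ?E0 !mxE ?big_ord1 ?mxE//=.
  by rewrite mulr1n divfK.
  by rewrite mulrAC addrC subrK.
have dL : \det L = 1 by rewrite det_lblock !det1 mulr1.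
have dU : \det U = G ord0 ord0 * \det (schur G) by rewrite det_ublock det_scalar1.
by rewrite -dU -[RHS]mul1r -dL [in LHS]GE; exact: det_mulmx.
Qed.

Lemma psd_schur n (G : 'M[C]_n.+1) : herm_mx G -> 0 < G ord0 ord0 -> psd_mx G ->
  psd_mx (schur G).
Proof.
move=> hG a0 pG x.
set a := G ord0 ord0 in a0 *.
have aC : a^* = a by rewrite conj_Creal// ger0_real// ltW.
have an0 : a != 0 by rewrite gt_eqF.
pose s := \sum_i x i * G (lift ord0 i) ord0.
have sC : s^* = \sum_j (x j)^* * G ord0 (lift ord0 j).
  by rewrite rmorph_sum; apply: eq_bigr => j _; rewrite rmorphM/= -hG.
(* The first coordinate [- s / a] minimises the quadratic form of [G] among the extensions of [x],
   and the minimum is the quadratic form of the Schur complement. *)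
pose y i := oapp x (- s / a) (unlift ord0 i).
have y0 : y ord0 = - s / a by rewrite /y unlift_none.
have yS i : y (lift ord0 i) = x i by rewrite /y liftK.
have := pG y.
suff -> : quad_form G y = quad_form (schur G) x by [].
pose B := \sum_i \sum_j x i * (x j)^* * G (lift ord0 i) (lift ord0 j).
have -> : quad_form (schur G) x = B - s * s^* / a.
  rewrite sC /s mulr_suml mulr_suml -sumrB; apply: eq_bigr => i _.
  rewrite mulr_sumr mulr_suml -sumrB; apply: eq_bigr => j _.
  by rewrite mxE -/a; field.
have -> : quad_form G y = y ord0 * (y ord0)^* * a + y ord0 * s^* +
    (y ord0)^* * s + B.
  rewrite /quad_form big_ord_recl big_ord_recl -/a -!addrA; congr (_ + _).
  rewrite sC mulr_sumr; congr (_ + _).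
    by apply: eq_bigr => j _; rewrite yS mulrA.
  rewrite mulr_sumr -big_split/=; apply: eq_bigr => i _.
  rewrite big_ord_recl !yS; congr (_ + _); first by ring.
  by apply: eq_bigr => j _; rewrite yS.
rewrite y0 rmorphM rmorphN/= fmorphV/= aC; field.
exact: an0.
Qed.

Lemma hermitian_schur n (G : 'M[C]_n.+1) : herm_mx G -> herm_mx (schur G).
Proof.
move=> hG i j; rewrite !mxE !rmorphB !rmorphM/= fmorphV/= -!hG.
by congr (_ - _ / _); rewrite mulrC.
Qed.

Lemma psd_col0 n (G : 'M[C]_n.+1) i : herm_mx G -> psd_mx G ->
  G ord0 ord0 = 0 -> G (lift ord0 i) ord0 = 0.
Proof.
move=> hG pG a0.
apply/eqP/contraT => u0; set u := G _ _ in u0.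
set b := G (lift ord0 i) (lift ord0 i).
have b0 : 0 <= b by exact: psd_diag_ge0.
have uu0 : 0 < u * u^* by rewrite mul_conjC_gt0.
(* With this [t] the form at the vector [y] below equals [b - 2 t |u|^2 = - (b + 2)], which is
   negative. *)
pose t := (b + 1) / (u * u^*).
have tC : t^* = t by rewrite conj_Creal// ger0_real// divr_ge0 ?addr_ge0// ltW.
pose y j := if j == ord0 then - t * u else (j == lift ord0 i)%:R : C.
have := pG y; rewrite /quad_form big_ord_recl big_ord_recl a0 mulr0 add0r.
have yS j : y (lift ord0 j) = (j == i)%:R by rewrite /y/= (inj_eq lift_inj).
have pick (F : 'I_n -> C) : \sum_j (j == i)%:R * F j = F i.
  rewrite (bigD1 i)//= big1 ?addr0 ?eqxx ?mul1r// => j /negPf ->.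
  by rewrite mul0r.
under eq_bigr do rewrite yS rmorph_nat mulrAC mulrC.
rewrite pick.
under [X in _ + X]eq_bigr => j _.
  rewrite big_ord_recl yS -!mulrA.
  under eq_bigr => l _ do rewrite yS rmorph_nat -mulrA mulrCA.
  rewrite pick -mulrDr; over.
rewrite pick {pick}.
rewrite /y/= -/u -/b (hG (lift ord0 i) ord0) -/u.
have -> : - t * u * u^* + ((- t * u)^* * u + b) = - (b + 2).
  rewrite rmorphM rmorphN/= tC /t; field.
  by rewrite conjC_eq0 u0.
by rewrite oppr_ge0 => /le_gtF; rewrite ltr_wpDl.
Qed.

(** Induction through the Schur complement, which is again Hermitian and positive and whose diagonal
    entries are at most those of [G]. If the pivot is zero, the whole first column is zero and so is
    the determinant. *)
Lemma hadamard n (G : 'M[C]_n) : herm_mx G -> psd_mx G ->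
  0 <= \det G <= \prod_i G i i.
Proof.
elim: n => [|n IH] in G *; first by rewrite det_mx00 big_ord0 lexx ler01.
move=> hG pG; rewrite big_ord_recl.
have := psd_diag_ge0 ord0 pG; rewrite le_eqVlt => /predU1P[/esym a0|a0].
  rewrite a0 mul0r.
  suff -> : \det G = 0 by rewrite lexx.
  rewrite (expand_det_col _ ord0) big1// => i _.
  case: (unliftP ord0 i) => [j|] ->; last by rewrite a0 mul0r.
  by rewrite psd_col0// mul0r.
have /andP[d0 dle] := IH _ (hermitian_schur hG) (psd_schur hG a0 pG).
rewrite det_schur ?gt_eqF//; apply/andP; split; first by rewrite mulr_ge0// ltW.
rewrite ler_pM2l//; apply: le_trans dle _.
apply: ler_prod => i _; rewrite psd_diag_ge0 /=; last exact: psd_schur.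
rewrite mxE lerBlDr lerDl divr_ge0 ?(ltW a0)// (hG (lift ord0 i)).
exact: mul_conjC_ge0.
Qed.

End hadamard.

(** * Poisson weights *)

Lemma gin_cardE N M k : (1 <= k <= M)%N -> gin_card N M k = ((N + M - k) %/ M)%N.
Proof.
move=> /andP[k1 kM]; rewrite /gin_card /gin_index size_filter.
elim: N => [|N IH]; first by rewrite /= add0n divn_small//; lia.
have -> : iota 1 N.+1 = iota 1 N ++ [:: N.+1] by have := iotaD 1 N 1; rewrite addn1 add1n.
rewrite count_cat IH /= addn0 addnC.
have -> : (N.+1 + M - k = (N + M - k).+1)%N by lia.
(* The quotient grows by one exactly when [M] divides [N + 1 + M - k], that is when [N + 1] is
   congruent to [k]. *)
rewrite divnS; last by lia.
congr (nat_of_bool _ + _)%N.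
have -> : ((N + M - k).+1 = N.+1 + M - k)%N by lia.
by rewrite -eqn_mod_dvd ?(leq_trans kM) ?leq_addl// modnDr.
Qed.

Section poisson.
Variable R : realType.
Implicit Types (l : R) (n L : nat).

Definition poisson_weight l n : R := l ^+ n / n`!%:R * expR (- l).

Local Notation p := poisson_weight.

Lemma poisson_weight_ge0 l n : 0 <= l -> 0 <= p l n.
Proof. by move=> l0; rewrite mulr_ge0 ?expR_ge0// divr_ge0 ?exprn_ge0. Qed.

Lemma poisson_weightS l n : n.+1%:R * p l n.+1 = l * p l n.
Proof.
rewrite /p factS natrM exprS; field.
by rewrite nat1r !pnatr_eq0/= -lt0n fact_gt0.
Qed.

Lemma cvg_sum_poisson_weight l : \sum_(n < L) p l n @[L --> \oo] --> (1 : R).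
Proof.
have -> : 1 = expR l * expR (- l) :> R by rewrite -expRD subrr expR0.
have -> : (fun L => \sum_(n < L) p l n) =
    (fun L => series (exp_coeff l) L * expR (- l)).
  apply/funext => L; rewrite /series/= big_mkord mulr_suml.
  by apply: eq_bigr.
apply: cvgMr_tmp; exact: is_cvg_series_exp_coeff.
Qed.

Lemma sum_poisson_weight_le1 l L : 0 <= l -> \sum_(n < L) p l n <= 1.
Proof.
move=> l0; rewrite -(cvg_lim _ (@cvg_sum_poisson_weight l))//.
apply: (@nondecreasing_cvgn_le _ (fun L => \sum_(n < L) p l n)).
  apply/nondecreasing_seqP => n; rewrite big_ord_recr/= lerDl.
  exact: poisson_weight_ge0.
by apply/cvg_ex; exists 1; exact: cvg_sum_poisson_weight.
Qed.

(** The truncated second moment telescopes by [poisson_weightS]. The subtracted boundary term is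
    nonnegative once [l <= L], which is how the variance bound comes out. *)
Lemma poisson_weight_varE l L : \sum_(n < L) p l n * (n%:R - l) ^+ 2 =
  l * \sum_(n < L) p l n - L%:R * (L%:R - l) * p l L.
Proof.
elim: L => [|L IH]; first by rewrite !big_ord0 !mul0r mulr0 subr0.
rewrite !big_ord_recr/= IH.
rewrite [X in _ = _ - X]mulrAC poisson_weightS -natr1; ring.
Qed.

Lemma poisson_weight_var l L : 0 <= l ->
  \sum_(n < L) p l n * (n%:R - l) ^+ 2 <= l.
Proof.
move=> l0.
(* The boundary term has a known sign only for indices beyond [l], so the sum is first extended by
   nonnegative terms. *)
have [m lm] : exists m, l <= m%:R.
  by exists (Num.trunc l).+1; exact/ltW/truncnS_gt.
apply: (@le_trans _ _ (\sum_(n < L + m) p l n * (n%:R - l) ^+ 2)).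
  rewrite big_split_ord/= lerDl sumr_ge0// => i _.
  by rewrite mulr_ge0 ?sqr_ge0// poisson_weight_ge0.
rewrite poisson_weight_varE lerBlDr.
apply: (@le_trans _ _ l).
  by rewrite ler_piMr// sum_poisson_weight_le1.
rewrite lerDl mulr_ge0 ?poisson_weight_ge0// mulr_ge0// subr_ge0.
by rewrite (le_trans lm)// ler_nat leq_addl.
Qed.

(** Chebyshev's inequality, applied to finite pieces of the tail and passed to the limit. *)
Lemma poisson_weight_tail l L : 0 <= l -> l < L%:R ->
  1 - \sum_(n < L) p l n <= l / (L%:R - l) ^+ 2.
Proof.
move=> l0 lL; have d0 : 0 < L%:R - l by rewrite subr_gt0.
rewrite ler_pdivlMr ?exprn_gt0//.
have h : (\sum_(n < L + L') p l n @[L' --> \oo] --> (1 : R)).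
  have := @cvg_sum_poisson_weight l; rewrite -(cvg_shiftn L).
  by under eq_fun do rewrite addnC.
have : (\sum_(n < L + L') p l n - \sum_(n < L) p l n) * (L%:R - l) ^+ 2
   @[L' --> \oo] --> (1 - \sum_(n < L) p l n) * (L%:R - l) ^+ 2.
  by apply: cvgMr_tmp; apply: cvgB => //; exact: cvg_cst.
move=> h2; rewrite -(cvg_lim _ h2)//.
apply: limr_le; first by apply/cvg_ex; eexists; exact: h2.
apply: nearW => L'; apply: le_trans (poisson_weight_var (L + L') l0).
rewrite !big_split_ord/= addrAC subrr add0r mulr_suml.
rewrite ler_wpDl ?sumr_ge0//.
  by move=> i _; rewrite mulr_ge0 ?sqr_ge0// poisson_weight_ge0.
apply: ler_sum => i _; rewrite ler_wpM2l ?poisson_weight_ge0//.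
rewrite ler_sqr ?nnegrE ?(ltW d0)//; first by rewrite lerB// ler_nat leq_addr.
by rewrite subr_ge0 (le_trans (ltW lL))// ler_nat leq_addr.
Qed.

(* AM-GM linearises |1 - n/l|, so that the variance bound applies. *)
Lemma poisson_weight_variation l L : 0 < l ->
  \sum_(n < L) `|p l n.+1 - p l n| <= (Num.sqrt l)^-1.
Proof.
move=> l0; set s := Num.sqrt l.
have s0 : 0 < s by rewrite sqrtr_gt0.
have ls : l = s ^+ 2 by rewrite sqr_sqrtr// ltW.
(* The weight [s], the square root of [l], balances the two halves of the majorant: each of the two
   sums is at most [s^-1]. *)
pose F n := p l n * (s^-1 + s * ((n%:R - l) / l) ^+ 2) / 2.
have F0 n : 0 <= F n.
  rewrite divr_ge0// mulr_ge0 ?poisson_weight_ge0 ?ltW//.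
  by rewrite ltr_pwDl ?invr_gt0// mulr_ge0 ?sqr_ge0// ltW.
apply: (@le_trans _ _ (\sum_(n < L) F n.+1)).
  apply: ler_sum => n _.
  have -> : p l n.+1 - p l n = - (p l n.+1 * ((n.+1%:R - l) / l)).
    have -> : p l n = n.+1%:R * p l n.+1 / l.
      by rewrite poisson_weightS [l * _]mulrC mulfK ?gt_eqF.
    by field; rewrite gt_eqF.
  rewrite normrN normrM ger0_norm ?poisson_weight_ge0 ?(ltW l0)//.
  rewrite /F -mulrA ler_wpM2l ?poisson_weight_ge0 ?(ltW l0)//.
  set y := (_ - _) / _.
  rewrite -[in X in _ <= X]real_normK ?num_real//.
  have : 0 <= s^-1 * (s * `|y| - 1) ^+ 2 by rewrite mulr_ge0 ?sqr_ge0 ?invr_ge0 ?ltW.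
  have -> : s^-1 * (s * `|y| - 1) ^+ 2 = s * `|y| ^+ 2 - 2 * `|y| + s^-1.
    by field; rewrite gt_eqF.
  lra.
apply: (@le_trans _ _ (\sum_(n < L.+1) F n)).
  by rewrite big_ord_recl lerDr.
have -> : \sum_(n < L.+1) F n = (s^-1 * \sum_(n < L.+1) p l n +
    s / l ^+ 2 * \sum_(n < L.+1) p l n * (n%:R - l) ^+ 2) / 2.
  rewrite mulr_sumr mulr_sumr -big_split/= mulr_suml; apply: eq_bigr => n _.
  by rewrite /F; field; rewrite !gt_eqF.
have h1 : s^-1 * \sum_(n < L.+1) p l n <= s^-1.
  by rewrite ler_piMr ?invr_ge0 ?(ltW s0)// sum_poisson_weight_le1// ltW.
have h2 : s / l ^+ 2 * \sum_(n < L.+1) p l n * (n%:R - l) ^+ 2 <= s^-1.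
  apply: (@le_trans _ _ (s / l ^+ 2 * l)).
    by rewrite ler_wpM2l ?poisson_weight_var ?divr_ge0 ?exprn_ge0// ltW.
  by rewrite le_eqVlt ls; apply/orP; left; apply/eqP; field; rewrite gt_eqF.
by lra.
Qed.

(** Cut the integers into blocks of length [M]. Within a block, two weights differ by at most the
    variation of the weights over that block, so replacing each of the [M] weights by the one at
    residue [r] costs in total [M] times the variation bounded above. *)
Lemma poisson_weight_block l M r c : 0 < l -> (r < M)%N ->
  `|M%:R * \sum_(i < c) p l (r + M * i) - \sum_(n < M * c) p l n| <=
  M%:R / Num.sqrt l.
Proof.
move=> l0 rM.
have blk i j : (j < M)%N -> `|p l (r + M * i) - p l (j + M * i)| <=
    \sum_(m < M) `|p l (m + M * i).+1 - p l (m + M * i)|.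
  move=> jM.
  have tel a b : (a <= b < M)%N -> `|p l (b + M * i) - p l (a + M * i)| <=
      \sum_(m < M) `|p l (m + M * i).+1 - p l (m + M * i)|.
    move=> /andP[ab bM].
    rewrite -(telescope_sumr (fun m => p l (m + M * i)%N))//.
    rewrite -(big_mkord xpredT (fun m => `|p l (m + M * i).+1 - p l (m + M * i)|)).
    apply: le_trans (ler_norm_sum _ _ _) _.
    rewrite (@big_cat_nat _ _ _ b 0 M) //=; last exact: ltnW.
    rewrite (@big_cat_nat _ _ _ a 0 b) //=.
    by rewrite -addrA addrCA lerDl addr_ge0// sumr_ge0.
  have [jr|/ltnW rj] := leqP j r; first by rewrite tel ?jr.
  by rewrite distrC tel ?rj.
have S c' (F : nat -> R) : \sum_(n < M * c') F n = \sum_(i < c') \sum_(j < M) F (j + M * i)%N.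
  elim: c' => [|c' IH]; first by rewrite muln0 !big_ord0.
  rewrite mulnSr big_split_ord/= IH big_ord_recr/=; congr (_ + _).
  by apply: eq_bigr => j _; rewrite addnC.
rewrite S mulr_sumr -sumrB.
apply: le_trans (ler_norm_sum _ _ _) _.
apply: (@le_trans _ _ (M%:R * \sum_(n < M * c) `|p l n.+1 - p l n|)); last first.
  by rewrite ler_wpM2l// poisson_weight_variation.
rewrite (S _ (fun n => `|p l n.+1 - p l n|)) mulr_sumr.
apply: ler_sum => i _.
rewrite mulr_natl -[M in _ *+ M]card_ord -sumr_const -sumrB.
apply: le_trans (ler_norm_sum _ _ _) _.
rewrite mulr_natl -[M in _ *+ M]card_ord -sumr_const.
by apply: ler_sum => j _; exact: blk.
Qed.

End poisson.

(** * Poisson probability of a residue class below the cutoff *)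

Section poisson_limit.
Variable R : realType.
Local Notation p := (@poisson_weight R).

Lemma cvg_dist_squeeze (u v : nat -> R) (a : R) :
  (\forall n \near \oo, `|u n - a| <= v n) -> v @ \oo --> 0 -> u @ \oo --> a.
Proof.
move=> uv v0; apply/cvgrPdist_le => e e0.
near=> n; rewrite distrC; apply: (@le_trans _ _ (v n)).
  by near: n; exact: uv.
apply: le_trans (ler_norm _) _.
by near: n; exact: cvgr0_norm_le.
Unshelve. all: by end_near. Qed.

Lemma cvg_natV : (n%:R^-1 : R) @[n --> \oo] --> 0.
Proof. by rewrite -cvg_shiftS; exact: cvg_harmonic. Qed.

Lemma cvg_gin_card_ratio M k : (1 <= k <= M)%N ->
  ((M * gin_card n M k)%:R / n%:R : R) @[n --> \oo] --> (1 : R).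
Proof.
move=> kM; apply: (@cvg_dist_squeeze _ (fun n => M%:R * n%:R^-1)); last first.
  by rewrite -(mulr0 (M%:R : R)); apply: cvgMl_tmp; exact: cvg_natV.
exists 1%N => // n /= n0.
have n0' : (n%:R : R) != 0 by rewrite pnatr_eq0 -lt0n.
rewrite -[X in _ - X](divff n0') -mulrBl normrM normfV [`|n%:R|]ger0_norm//.
rewrite ler_wpM2r ?invr_ge0// gin_cardE//.
set q := ((n + M - k) %/ M)%N.
have [h1 h2] : ((M * q <= n + M) /\ (n <= M * q + M))%N.
  have := divn_eq (n + M - k) M; have : ((n + M - k) %% M < M)%N by rewrite ltn_mod; lia.
  rewrite -/q; nia.
have {}h1 : (M * q)%:R <= n%:R + M%:R :> R by rewrite -natrD ler_nat.
have {}h2 : n%:R <= (M * q)%:R + M%:R :> R by rewrite -natrD ler_nat.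
by rewrite ler_norml; apply/andP; split; lra.
Qed.

(** Two errors: equidistribution modulo [M] is [poisson_weight_block], of order [n^(-1/2)]; the loss
    beyond the cutoff [M * c] is [poisson_weight_tail], of order [1 / n], because [x < 1] keeps the
    mean [n x] below the cutoff by a fixed fraction of [n]. *)
Lemma cvg_poisson_class M k (x : R) : (1 <= k <= M)%N -> 0 < x < 1 ->
  (n%:R / (gin_card n M k)%:R *
    \sum_(i < gin_card n M k) p (n%:R * x) (k.-1 + M * i)) @[n --> \oo] --> (1 : R).
Proof.
move=> kM /andP[x0 x1]; have M0 : (M%:R : R) != 0 by rewrite pnatr_eq0; lia.
pose A n : R := M%:R * \sum_(i < gin_card n M k) p (n%:R * x) (k.-1 + M * i).
suff A1 : A @ \oo --> (1 : R).
  have h : (A n / ((M * gin_card n M k)%:R / n%:R)) @[n --> \oo] --> (1 : R).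
    suff : (A n / ((M * gin_card n M k)%:R / n%:R)) @[n --> \oo] --> (1 * 1^-1 : R).
      by rewrite invr1 mulr1.
    by apply: cvgM => //; apply: cvgV; [exact: oner_neq0|exact: cvg_gin_card_ratio].
  apply: cvg_trans h; apply: near_eq_cvg.
  exists M => // n /= nM; rewrite /A/= natrM.
  have c0 : ((gin_card n M k)%:R : R) != 0.
    by rewrite pnatr_eq0 gin_cardE// -lt0n divn_gt0; lia.
  by rewrite invf_div; field; rewrite c0 M0.
(* Half of the gap: the cutoff [M * c] is at least [n - k], and the other half of the gap absorbs
   [k] as soon as [n >= k / d]. *)
pose d := (1 - x) / 2.
have d0 : 0 < d by rewrite divr_gt0// subr_gt0.
apply: (@cvg_dist_squeeze _ (fun n => M%:R * Num.sqrt (n%:R^-1 * x^-1) +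
    (x / d ^+ 2) * n%:R^-1)); last first.
  rewrite -[0]addr0; apply: cvgD.
    rewrite -(mulr0 (M%:R : R)); apply: cvgMl_tmp.
    rewrite -[X in _ --> X]sqrtr0; apply: continuous_cvg; first exact: sqrt_continuous.
    by rewrite -(mul0r x^-1); apply: cvgMr_tmp; exact: cvg_natV.
  by rewrite -(mulr0 (x / d ^+ 2)); apply: cvgMl_tmp; exact: cvg_natV.
near=> n.
have n0 : 0 < n%:R :> R by near: n; exact: nbhs_infty_gtr.
set c := gin_card n M k; set l := n%:R * x.
have l0 : 0 < l by rewrite mulr_gt0.
have Mc : (n <= M * c + k)%N.
  rewrite /c gin_cardE//; have := divn_eq (n + M - k) M.
  have : ((n + M - k) %% M < M)%N by rewrite ltn_mod; lia.
  lia.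
have dM : n%:R * d <= (M * c)%:R - l.
  have : k%:R / d <= n%:R by near: n; exact: nbhs_infty_ger.
  rewrite ler_pdivrMr// => h.
  have : n%:R <= (M * c + k)%:R :> R by rewrite ler_nat.
  rewrite natrD /l; have : d * 2 = 1 - x by rewrite divfK.
  nra.
have nd0 : 0 < n%:R * d by rewrite mulr_gt0.
have lMc : l < (M * c)%:R by rewrite -subr_gt0; exact: lt_le_trans dM.
rewrite -(subrK (\sum_(i < M * c) p l i) (A n)) -addrA.
apply: le_trans (ler_normD _ _) _; apply: lerD.
  have kM' : (k.-1 < M)%N by lia.
  apply: le_trans (poisson_weight_block _ l0 kM') _.
  by rewrite -sqrtrV ?(ltW l0)// /l invfM mulrC.
rewrite distrC ger0_norm; last by rewrite subr_ge0 sum_poisson_weight_le1// ltW.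
apply: le_trans (poisson_weight_tail (ltW l0) lMc) _.
apply: (@le_trans _ _ (l / (n%:R * d) ^+ 2)).
  rewrite ler_wpM2l ?(ltW l0)// lef_pV2 ?posrE ?exprn_gt0// ?(lt_le_trans nd0)//.
  by rewrite ler_sqr ?nnegrE ?(ltW nd0)// (le_trans (ltW nd0)).
rewrite le_eqVlt; apply/orP; left; apply/eqP; rewrite /l; field.
by rewrite !gt_eqF.
Unshelve. all: by end_near. Qed.

End poisson_limit.

(** * Lebesgue measure on the plane *)

Section affine_lebesgue.
Variable R : realType.
Local Open Scope ereal_scope.

(** The image of Lebesgue measure under the affine map, multiplied by [s], gives half-open intervals
    their length, so it is Lebesgue measure by uniqueness. *)
Lemma lebesgue_measure_affine (s t : R) (B : set (measurableTypeR R)) :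
    (0 < s)%R -> measurable B ->
  lebesgue_measure ((fun y : measurableTypeR R => (s * y + t)%R : measurableTypeR R) @^-1` B) =
  s^-1%:E * lebesgue_measure B.
Proof.
move=> s0 mB; pose g : measurableTypeR R -> measurableTypeR R := fun y => (s * y + t)%R.
have mg : measurable_fun setT g.
  by apply: measurable_funD => //; exact: measurable_funM.
pose mu : {measure set (measurableTypeR R) -> \bar R} :=
  mscale (NngNum (ltW s0)) (pushforward lebesgue_measure g).
have sV : (s^-1 * s)%R = 1%R by rewrite mulVf// gt_eqF.
have -> : lebesgue_measure B = mu mg B.
  apply: lebesgue_measure_unique => // _ [[a b]] _ <-.
  have E : g @^-1` `]a, b] = `]((a - t) / s)%R, ((b - t) / s)%R]%classic.
    apply/seteqP; split => y /=; rewrite !in_itv/= /g => /andP[ay yb];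
      apply/andP; split.
    - by rewrite ltr_pdivrMr// ltrBlDr mulrC.
    - by rewrite ler_pdivlMr// lerBrDr mulrC.
    - by rewrite -ltrBlDr mulrC -ltr_pdivrMr.
    - by rewrite -lerBrDr mulrC -ler_pdivlMr.
  change (lebesgue_measure `]a, b] = s%:E * lebesgue_measure (g @^-1` `]a, b])).
  rewrite E !lebesgue_measure_itv/= !lte_fin ltr_pM2r ?invr_gt0// ltrD2r.
  case: ifPn => _; last by rewrite mule0.
  by rewrite -!EFinB -EFinM; congr EFin; field; rewrite gt_eqF.
by rewrite /mu/= /mscale/= muleA -EFinM sV mul1e.
Qed.

End affine_lebesgue.

Section plane_maps.
Variable R : realType.
Local Open Scope ereal_scope.
Notation m := (@plane_lebesgue R).

Lemma preimage_measurable d1 d2 (T1 : measurableType d1) (T2 : measurableType d2)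
  (g : T1 -> T2) A : measurable_fun setT g -> measurable A -> measurable (g @^-1` A).
Proof. by move=> mg mA; rewrite -[X in measurable X]setTI; exact: mg. Qed.

Lemma plane_lebesgue_swap A : measurable A ->
  m (swap @^-1` A) = m A.
Proof.
move=> mA; symmetry.
have ms : measurable_fun setT (@swap (measurableTypeR R) (measurableTypeR R)).
  exact: measurable_swap.
apply: (@product_measure_unique _ _ _ _ _ lebesgue_measure lebesgue_measure
  (pushforward m (@swap _ _))) => //.
move=> B C mB mC; rewrite /pushforward.
transitivity (m (C `*` B)).
  by congr (m _); apply/seteqP; split => -[x y] [].
by rewrite /plane_lebesgue [LHS]product_measure1E// muleC.
Qed.

(** Tonelli along vertical lines, on each of which preimages have [c] times the measure. Shears and
    vertical dilations are instances; conjugation by [swap] gives the horizontal ones. *)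
Lemma plane_lebesgue_fiber (T : R -> R -> R) (c : R) :
    (0 <= c)%R -> measurable_fun setT (fun z : plane R => T z.1 z.2 : measurableTypeR R) ->
    (forall x B, measurable B ->
      lebesgue_measure ((T x : measurableTypeR R -> measurableTypeR R) @^-1` B)
      = c%:E * lebesgue_measure B) ->
  forall A, measurable A ->
  m ((fun z : plane R => (z.1, T z.1 z.2) : plane R) @^-1` A) = c%:E * m A.
Proof.
move=> c0 mT h A mA; rewrite /plane_lebesgue /product_measure1.
rewrite -ge0_integralZl//; last exact: measurable_fun_xsection.
apply: eq_integral => x _ /=; rewrite -(h x); last exact: measurable_xsection.
congr (lebesgue_measure _); apply/seteqP; split => y /=;
  by rewrite /xsection/= !inE.
Qed.

Definition plane_shear (t : R) (z : plane R) : plane R := (z.1, (z.2 + t * z.1)%R).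

Lemma measurable_plane_shear t : measurable_fun setT (plane_shear t).
Proof.
apply/measurable_fun_pair => /=; first exact: measurable_fst.
by apply: measurable_funD => //; exact: measurable_funM.
Qed.

Lemma plane_lebesgue_shear t A : measurable A -> m (plane_shear t @^-1` A) = m A.
Proof.
move=> mA; rewrite (@plane_lebesgue_fiber (fun x y => y + t * x)%R 1%R)//.
- by rewrite mul1e.
- by apply: measurable_funD => //; exact: measurable_funM.
- move=> x B mB; rewrite mul1e; have := lebesgue_measure_affine (t * x) ltr01 mB.
  by rewrite invr1 mul1e; under eq_fun do rewrite mul1r.
Qed.

Definition plane_dilate2 (s : R) (z : plane R) : plane R := (z.1, (s * z.2)%R).

Lemma measurable_plane_dilate2 s : measurable_fun setT (plane_dilate2 s).
Proof.
apply/measurable_fun_pair => /=; first exact: measurable_fst.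
exact: measurable_funM.
Qed.

Lemma plane_lebesgue_dilate2 s A : (0 < s)%R -> measurable A ->
  m (plane_dilate2 s @^-1` A) = s^-1%:E * m A.
Proof.
move=> s0 mA; rewrite (@plane_lebesgue_fiber (fun x y => s * y)%R s^-1%R)//.
- by rewrite invr_ge0 ltW.
- exact: measurable_funM.
- move=> x B mB; have := lebesgue_measure_affine 0 s0 mB.
  by under eq_fun do rewrite addr0.
Qed.

Definition plane_dilate (s : R) (z : plane R) : plane R := (s * z.1, s * z.2)%R.

Lemma measurable_plane_dilate s : measurable_fun setT (plane_dilate s).
Proof. by apply/measurable_fun_pair => /=; exact: measurable_funM. Qed.

Lemma plane_lebesgue_dilate s A : (0 < s)%R -> measurable A ->
  m (plane_dilate s @^-1` A) = (s ^- 2)%:E * m A.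
Proof.
move=> s0 mA.
have ms : measurable_fun setT (@swap (measurableTypeR R) (measurableTypeR R)).
  exact: measurable_swap.
have md := measurable_plane_dilate2 s.
(* The dilation is two vertical dilations, one of them conjugated by [swap]; each contributes a
   factor [s^-1]. *)
have -> : plane_dilate s @^-1` A =
  plane_dilate2 s @^-1` (swap @^-1` (plane_dilate2 s @^-1` (swap @^-1` A))) by [].
do 3 (rewrite ?plane_lebesgue_dilate2 ?plane_lebesgue_swap//;
  repeat apply: preimage_measurable => //).
by rewrite muleA -EFinM -invfM expr2.
Qed.

Definition plane_rot (c s : R) (z : plane R) : plane R :=
  (c * z.1 - s * z.2, s * z.1 + c * z.2)%R.

Lemma measurable_plane_rot c s : measurable_fun setT (plane_rot c s).
Proof.
apply/measurable_fun_pair => /=.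
  by apply: measurable_funB => //; exact: measurable_funM.
by apply: measurable_funD => //; exact: measurable_funM.
Qed.

(* A rotation is a product of three shears. *)
Lemma plane_lebesgue_rot c s A : (c ^+ 2 + s ^+ 2 = 1)%R -> (0 < s)%R ->
  measurable A -> m (plane_rot c s @^-1` A) = m A.
Proof.
move=> cs s0 mA.
have c1 : (1 + c != 0)%R.
  apply/eqP => c1; have : (c = -1)%R by lra.
  by move=> cE; move: cs; rewrite cE sqrrN expr1n => cs; nra.
(* Minus the tangent of the half angle, the slope of the outer two shears. The sign of [s] excludes
   [c = - 1], where it is infinite. *)
pose t := (- (s / (1 + c)))%R.
have ms : measurable_fun setT (@swap (measurableTypeR R) (measurableTypeR R)).
  exact: measurable_swap.
have msh u := measurable_plane_shear u.
have tc : (t * (1 + c) = - s)%R by rewrite /t mulNr divfK.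
have st : (1 + s * t = c)%R.
  apply: (mulIf c1); rewrite mulrDl -mulrA tc; lra.
clearbody t.
have -> : plane_rot c s @^-1` A = swap @^-1` (plane_shear t @^-1` (swap @^-1`
   (plane_shear s @^-1` (swap @^-1` (plane_shear t @^-1` (swap @^-1` A)))))).
  suff E : plane_rot c s = swap \o plane_shear t \o swap \o plane_shear s
      \o swap \o plane_shear t \o swap by rewrite E.
  apply/funext => -[x y]; rewrite /plane_rot /plane_shear/swap/=.
  congr pair; last by rewrite -st; ring.
  have -> : (c * x - s * y = (1 + s * t) * x + (t * (1 + (1 + s * t))) * y)%R.
    by rewrite st tc; ring.
  ring.
by rewrite !(plane_lebesgue_swap, plane_lebesgue_shear)//;
  repeat apply: preimage_measurable => //.
Qed.

End plane_maps.

(** * Measures given by a density *)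

Section density.
Local Open Scope ereal_scope.
Context d (T : measurableType d) (R : realType).
Variable mu : {sigma_finite_measure set T -> \bar R}.

(* The measure with density [w] is the image of the product measure restricted
   to the subgraph of [w]. *)
Lemma exists_density_measure (w : T -> R) :
    measurable_fun setT w -> (forall x, (0 <= w x)%R) ->
  exists nu : {measure set T -> \bar R}, forall f : T -> \bar R,
    measurable_fun setT f -> (forall x, 0 <= f x) ->
    \int[nu]_x f x = \int[mu]_x (f x * (w x)%:E).
Proof.
move=> mw w0.
pose leb := @lebesgue_measure R.
pose S : set (T * measurableTypeR R) := [set z | (0 <= z.2)%R /\ (z.2 < w z.1)%R].
have mS : measurable S.
  have -> : S = [set z | (0 <= z.2)%R] `&` [set z | (z.2 < w z.1)%R] by [].
  apply: measurableI.
    rewrite -[X in measurable X]setTI.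
    by apply: (@measurable_fun_ler _ _ _ setT (cst 0%R) snd _ _ measurableT [set true]) => //; exact: measurable_snd.
  rewrite -[X in measurable X]setTI.
  apply: (@measurable_fun_ltr _ _ _ setT snd (w \o fst) _ _ measurableT [set true]) => //.
  by apply: measurableT_comp => //; exact: measurable_fst.
pose m2 : {measure set (T * measurableTypeR R) -> \bar R} := (mu \x leb).
pose nu : {measure set T -> \bar R} := pushforward (mrestr m2 mS) (@fst T (measurableTypeR R)).
exists (nu (@measurable_fst _ _ T (measurableTypeR R))) => f mf f0.
rewrite (ge0_integral_pushforward (@measurable_fst _ _ T (measurableTypeR R)))//.
have mff : measurable_fun setT (f \o @fst T (measurableTypeR R)).
  by apply: measurableT_comp => //; exact: measurable_fst.
have n0 : \int[mrestr m2 mS]_(z in ~` S) (f \o fst) z = 0.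
  apply: null_set_integral.
  - exact: measurableC.
  - exact: measurable_funTS.
  - change (m2 (~` S `&` S) = 0); by rewrite setICl measure0.
transitivity (\int[m2]_(z in S) (f \o fst) z).
  rewrite preimage_setT -(setUv S) ge0_integral_setU//; last 4 first.
  - exact: measurableC.
  - by rewrite setUv.
  - by move=> z _; exact: f0.
  - by apply/disj_setPCl.
  rewrite n0 adde0.
  by apply: eq_measure_integral => A mA AS; change (m2 (A `&` S) = m2 A); rewrite setIidl.
rewrite integral_mkcond fubini_tonelli1//; last 2 first.
- by apply: (measurable_restrictT (f \o fst) mS).1; exact: measurable_funTS.
- by move=> z; rewrite patchE; case: ifP => // _; exact: f0.
apply: eq_integral => x _; rewrite /fubini_F.
transitivity (\int[leb]_(y in `[0%R, w x[) (cst (f x) y)).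
  rewrite [RHS]integral_mkcond; apply: eq_integral => y _.
  rewrite /patch; congr (if _ then _ else _).
  by apply/idP/idP; rewrite !inE /S/= in_itv/= => /andP.
rewrite integral_cst//= lebesgue_measure_itv/= lte_fin.
case: ltP => [|wx]; first by rewrite sube0.
by congr (_ * _%:E); apply/eqP; rewrite eq_le w0 wx.
Qed.

End density.

(** * The modulus and integrals over the plane *)

Section modulus.
Variable R : realType.
Implicit Types z : plane R.

Lemma modulusE z : modulus z = Num.sqrt (z.1 ^+ 2 + z.2 ^+ 2).
Proof. by []. Qed.

Lemma modulus_sqr z : modulus z ^+ 2 = z.1 ^+ 2 + z.2 ^+ 2.
Proof. by rewrite modulusE sqr_sqrtr// addr_ge0 ?sqr_ge0. Qed.

Lemma modulus_ge0 z : 0 <= modulus z.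
Proof. by rewrite modulusE sqrtr_ge0. Qed.

Lemma modulus_eq0 z : (modulus z == 0) = (z == (0, 0)).
Proof.
rewrite -sqrf_eq0 modulus_sqr paddr_eq0 ?sqr_ge0// !sqrf_eq0.
by case: z.
Qed.

Lemma measurable_modulus : measurable_fun setT (@modulus R).
Proof.
rewrite [X in measurable_fun _ X](_ : _ =
    (fun z : plane R => (z.1 ^+ 2 + z.2 ^+ 2) `^ 2^-1)); last first.
  by apply/funext => z; rewrite powR12_sqrt ?addr_ge0 ?sqr_ge0.
apply: (measurableT_comp (measurable_powR _)).
by apply: measurable_funD; apply: measurable_funX.
Qed.

Lemma modulus_dilate s z : 0 <= s -> modulus (plane_dilate s z) = s * modulus z.
Proof.
move=> s0; rewrite !modulusE /= !exprMn -mulrDr sqrtrM ?sqr_ge0//.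
by rewrite sqrtr_sqr ger0_norm.
Qed.

Lemma modulus_rot c s z : c ^+ 2 + s ^+ 2 = 1 -> modulus (plane_rot c s z) = modulus z.
Proof.
move=> cs; rewrite !modulusE /=; congr Num.sqrt.
rewrite -[RHS]mul1r -cs; ring.
Qed.

End modulus.

Section plane_integral.
Variable R : realType.
Local Open Scope ereal_scope.
Notation m := (@plane_lebesgue R).

Lemma integral_dilate (s : R) (F : plane R -> \bar R) : (0 < s)%R ->
    measurable_fun setT F -> (forall z, 0 <= F z) ->
  \int[m]_z F z = (s ^+ 2)%:E * \int[m]_z F (plane_dilate s z).
Proof.
move=> s0 mF F0; have md := measurable_plane_dilate s.
have s2 : (0 <= s ^- 2)%R by rewrite invr_ge0 sqr_ge0.
have := ge0_integral_pushforward md m measurableT mF (fun z _ => F0 z).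
rewrite preimage_setT => <-.
have -> : \int[pushforward m (plane_dilate s)]_y F y =
    \int[mscale (NngNum s2) m]_y F y.
  apply: eq_measure_integral.
  by move=> A mA _; exact: plane_lebesgue_dilate.
rewrite ge0_integral_mscale//= muleA -EFinM divff ?mul1e//.
by rewrite gt_eqF// exprn_gt0.
Qed.

(** The square of the one-dimensional Gaussian integral. This value is what fixes the constant in
    [integral_radial]. *)
Lemma integral_gauss_plane : \int[m]_z (expR (- modulus z ^+ 2))%:E = pi%:E.
Proof.
have mg : measurable_fun setT (@gauss_fun R) by exact: measurable_gauss_fun.
rewrite fubini_tonelli1//; last first.
  apply/measurable_EFinP; apply: measurableT_comp => //.
  apply: measurable_funN; apply: measurable_funX; exact: measurable_modulus.
rewrite /fubini_F.
have G : \int[@lebesgue_measure R]_y (expR (- y ^+ 2))%:E = (Num.sqrt pi)%:E.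
  exact: integralT_gauss.
have mE : measurable_fun setT (fun y : measurableTypeR R => (expR (- y ^+ 2))%:E).
  exact/measurable_EFinP.
have h x : \int[@lebesgue_measure R]_y (expR (- modulus ((x, y) : plane R) ^+ 2))%:E =
    (expR (- x ^+ 2))%:E * (Num.sqrt pi)%:E.
  under eq_integral => y _ do rewrite modulus_sqr/= opprD expRD EFinM.
  by rewrite ge0_integralZl// ?lee_fin ?expR_ge0// G.
under eq_integral => x _ do rewrite h.
by rewrite ge0_integralZr ?lee_fin ?sqrtr_ge0// G -EFinM -expr2 sqr_sqrtr// pi_ge0.
Qed.

Lemma plane_lebesgue_origin : m [set (0, 0)%R] = 0.
Proof.
have -> : [set (0, 0)%R] = [set 0%R] `*` [set 0%R] :> set (plane R).
  by apply/seteqP; split => -[x y] /=; [case=> -> ->|case=> -> ->].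
rewrite /plane_lebesgue product_measure1E//.
by rewrite [X in X * _](_ : _ = 0) ?mul0e//; exact: lebesgue_measure_set1.
Qed.

Lemma measurable_plane_origin : measurable ([set (0, 0)%R] : set (plane R)).
Proof.
have -> : [set (0, 0)%R] = [set 0%R] `*` [set 0%R] :> set (plane R).
  by apply/seteqP; split => -[x y] /=; [case=> -> ->|case=> -> ->].
by apply: measurableX; exact: measurable_set1.
Qed.

(** Real exponents of the modulus are added under a nonzero base, so the identities between weights
    are established off the origin, which is a null set. *)
Lemma ae_modulus_neq0 (Q : plane R -> Prop) :
  (forall z, modulus z != 0%R -> Q z) -> {ae m, forall z, Q z}.
Proof.
move=> h; exists [set (0, 0)%R]; split.
- exact: measurable_plane_origin.
- exact: plane_lebesgue_origin.
move=> z /= nQ; apply: contrapT => z0; apply: nQ; apply: h.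
by rewrite modulus_eq0; apply/eqP.
Qed.

End plane_integral.

(** * Radial integrals *)

Section homogeneous_measure.
Variable R : realType.
Local Open Scope ereal_scope.
Local Notation leb := (@lebesgue_measure R).
Local Notation itvoc a b := (`]a%R, b%R]%classic : set (measurableTypeR R)).
Variable mu : {measure set (measurableTypeR R) -> \bar R}.
Hypothesis mu_neg : mu (`]-oo, 0%R]%classic : set (measurableTypeR R)) = 0.
Hypothesis mu_scale : forall l a b : R, (0 < l)%R ->
  mu (itvoc (l * a) (l * b)) = l%:E * mu (itvoc a b).
Hypothesis mu_fin : mu (itvoc 2^-1 1) < +oo.

Let mitv (a b : R) : measurable (itvoc a b).
Proof. exact: measurable_itv. Qed.

Let muD (a b c : R) : (a <= b)%R -> (b <= c)%R ->
  mu (itvoc a c) = mu (itvoc a b) + mu (itvoc b c).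
Proof.
move=> ab bc; rewrite -measureU//=.
  by congr (mu _); rewrite -itv_bndbnd_setU// ?bnd_simp.
apply/seteqP; split => // x /= []; rewrite !in_itv/= => /andP[_ xb] /andP[bx _].
by move: bx; rewrite ltNge xb.
Qed.

(** Homogeneity lets finiteness on [(1/2, 1]] spread to [(0, 1]] by dyadic pieces. *)
Let mu01_fin : mu (itvoc 0 1) < +oo.
Proof.
pose F n : set (measurableTypeR R) := itvoc (2 ^- n) 1.
(* [F n.+1] is [(1/2, 1]] together with a copy of [F n] scaled by [1/2]. With [a] the mass of
   [(1/2, 1]], the bound [2 a] is preserved since [(2 a) / 2 + a = 2 a]. *)
have h n : mu (F n) <= 2%:E * mu (itvoc 2^-1 1).
  elim: n => [|n IH].
    by rewrite /F expr0 invr1 set_itvoc0 measure0 mule_ge0 ?lee_fin.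
  have e2 k : (0 < (2 ^- k : R))%R by rewrite invr_gt0 exprn_gt0.
  have e1 k : ((2 ^- k : R) <= 1)%R.
    by rewrite invf_le1 ?exprn_gt0// exprn_ege1// ler1n.
  rewrite /F (@muD _ (2^-1)%R); last 2 first.
  - by rewrite exprS invfM ler_piMr.
  - by rewrite invf_le1// ler1n.
  have -> : mu (itvoc (2 ^- n.+1) 2^-1) = 2^-1%:E * mu (F n).
    by rewrite -mu_scale// mulr1 exprS invfM.
  apply: (@le_trans _ _ (2^-1%:E * (2%:E * mu (itvoc 2^-1 1)) + mu (itvoc 2^-1 1))).
    by rewrite leeD2r// lee_wpmul2l// lee_fin.
  rewrite muleA -EFinM mulVf// mul1e.
  by rewrite -mule2n -[X in X <= _]mule_natl.
have := @nondecreasing_cvg_mu _ _ _ mu F (fun=> mitv _ _).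
have -> : \bigcup_n F n = (itvoc 0 1).
  apply/seteqP; split => x /=.
    move=> [n _]; rewrite /F/= !in_itv/= => /andP[x0 ->]; rewrite andbT.
    by apply: lt_trans x0; rewrite invr_gt0 exprn_gt0.
  rewrite in_itv/= => /andP[x0 x1].
  have /cvgrPdist_lt/(_ x x0)[n _ /(_ n (leqnn _))] := @cvg_geometric R 1 (2^-1)%R
    ltac:(by rewrite ger0_norm// invf_lt1// ltr1n).
  rewrite sub0r normrN /geometric/= mul1r ger0_norm ?exprn_ge0// exprVn => nx.
  by exists n => //; rewrite /F/= in_itv/= nx.
move=> /(_ (mitv _ _)) cvgF.
apply: (@le_lt_trans _ _ (2%:E * mu (itvoc 2^-1 1))); last first.
  by rewrite lte_mul_pinfty ?lee_fin.
have ndF : nondecreasing_seq F.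
  move=> p q pq; apply/subsetPset => x; rewrite /F/= !in_itv/= => /andP[px ->].
  rewrite andbT (le_lt_trans _ px)// lef_pV2 ?posrE ?exprn_gt0//.
  by rewrite ler_weXn2l// ler1n.
rewrite -(cvg_lim _ (cvgF ndF))//.
apply: lime_le; last by apply: nearW => n; exact: h.
by apply/cvg_ex; eexists; exact: (cvgF ndF).
Qed.

Let kappa : R := fine (mu (itvoc 0 1)).

Let kappa_ge0 : (0 <= kappa)%R.
Proof. by rewrite fine_ge0. Qed.

Let mu01 : mu (itvoc 0 1) = kappa%:E.
Proof. by rewrite fineK// ge0_fin_numE. Qed.

Let mu0b b : (0 <= b)%R -> mu (itvoc 0 b) = (kappa * b)%:E.
Proof.
rewrite le_eqVlt => /predU1P[<-|b0].
  by rewrite /= set_itvoc0 measure0 mulr0.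
have := @mu_scale b 0 1 b0; rewrite mulr0 mulr1 => ->.
by rewrite mu01 -EFinM mulrC.
Qed.

Let muab a b : (0 <= a)%R -> (a <= b)%R -> mu (itvoc a b) = (kappa * (b - a))%:E.
Proof.
move=> a0 ab; have := @muD 0 a b a0 ab.
rewrite !mu0b// ?(le_trans a0)// => /eqP.
rewrite addeC -sube_eq//; last by rewrite fin_num_adde_defl.
by move=> /eqP <-; rewrite -EFinB mulrBr.
Qed.

Let mu_nonpos a b : (b <= 0)%R -> mu (itvoc a b) = 0.
Proof.
move=> b0; apply: (@subset_measure0 _ _ _ mu _ `]-oo, 0%R]%classic) => //.
by move=> x; rewrite /= !in_itv/= => /andP[_ xb]; exact: le_trans b0.
Qed.

(** Scaling and additivity give [(a, b]] the mass [kappa * (b - a)] for [0 <= a], where [kappa] is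
    the mass of [(0, 1]]. Half-open intervals are stable under intersection and generate the Borel
    sets, so they determine the measure. *)
Lemma homogeneous_measureE : exists2 c : R, (0 <= c)%R &
  forall g : R -> \bar R, measurable_fun setT g -> (forall x, 0 <= g x) ->
  \int[mu]_x g x = c%:E * \int[leb]_(x in `[0%R, +oo[) g x.
Proof.
exists kappa => // g mg g0.
have mP : measurable (`[0%R, +oo[%classic : set (measurableTypeR R)).
  exact: measurable_itv.
pose nu : {measure set (measurableTypeR R) -> \bar R} :=
  mscale (NngNum kappa_ge0) (mrestr leb mP).
have nuE A : nu A = kappa%:E * leb (A `&` `[0%R, +oo[) by [].
have munu A : measurable A -> nu A = mu A.
  apply: (@measure_unique _ R (measurableTypeR R) (@ocitv R)
    (fun n => itvoc (- n%:R) n%:R) _ _ _ _ nu mu) => //.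
  - exact: ocitvI.
  - by move=> n; exact: is_ocitv.
  - apply/seteqP; split => // x _ /=.
    have [n xn] : exists n, (`|x : R| < n%:R)%R.
      by exists (Num.trunc `|x : R|).+1; exact: truncnS_gt.
    exists n => //=; rewrite in_itv/=; move: xn; rewrite ltr_norml => /andP[-> /ltW].
    by [].
  - move=> _ [[a b] _ <-] /=; rewrite nuE.
    have [ba|ab] := leP b a.
      rewrite set_itv_ge ?bnd_simp -?leNgt// set0I !measure0 mule0//.
    have [b0|b0] := leP b 0%R.
      rewrite mu_nonpos// (@subset_measure0 _ _ _ leb _ [set 0%R]) ?mule0//.
      - exact: measurableI.
      - move=> x /=; rewrite !in_itv/= andbT => -[/andP[_ xb] x0].
        by apply/eqP; rewrite eq_le x0 (le_trans xb b0).
      - exact: lebesgue_measure_set1.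
    have [a0|a0] := leP 0%R a.
      rewrite muab ?(ltW ab)// (_ : _ `&` _ = `]a, b]%classic); last first.
        apply: setIidl => x /=; rewrite !in_itv/= andbT => /andP[ax _].
        exact: ltW (le_lt_trans a0 ax).
      by rewrite lebesgue_measure_itv/= lte_fin ab -EFinM.
    rewrite (@muD a 0 b) ?(ltW a0) ?(ltW b0)// mu_nonpos// add0e mu0b ?ltW//.
    rewrite (_ : _ `&` _ = `[0%R, b]%classic); last first.
      apply/seteqP; split => x /=; rewrite !in_itv/= andbT.
        by move=> [/andP[_ ->] ->].
      by move=> /andP[x0 ->]; rewrite (lt_le_trans a0 x0).
    by rewrite lebesgue_measure_itv/= lte_fin b0 -EFinB subr0 -EFinM.
  - move=> n; rewrite nuE (@le_lt_trans _ _ (kappa%:E * leb (itvoc (- n%:R) n%:R)))//.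
      rewrite lee_wpmul2l ?lee_fin// le_measure// inE//; exact: measurableI.
    rewrite lebesgue_measure_itv/=; case: ifP => _; last by rewrite mule0 ltry.
    by rewrite -EFinB -EFinM ltry.
rewrite -(@eq_measure_integral _ _ _ setT mu nu); last by move=> A mA _; rewrite munu.
rewrite ge0_integral_mscale//=; congr (_ * _).
rewrite -(setUv `[0%R, +oo[%classic) ge0_integral_setU//; last 3 first.
- exact: measurableC.
- by rewrite setUv.
- by apply/disj_setPCl.
have -> : \int[mrestr leb mP]_(x in ~` `[0%R, +oo[%classic) g x = 0.
  apply: null_set_integral.
  - exact: measurableC.
  - exact: measurable_funTS.
  - change (leb (~` `[0%R, +oo[%classic `&` `[0%R, +oo[%classic) = 0).
    by rewrite setICl measure0.
rewrite adde0; apply: eq_measure_integral => A mA AS.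
by change (leb (A `&` `[0%R, +oo[%classic) = leb A); rewrite setIidl.
Qed.

End homogeneous_measure.

(** * Exponential integrals on the half-line *)

Section exponential_integrals.
Variable R : realType.
Local Notation leb := (@lebesgue_measure R).

Lemma cvg_expRn_y (a : R) n : 0 < a -> x ^+ n * expR (- (a * x)) @[x --> +oo] --> (0 : R).
Proof.
move=> a0; set c : R := (n.+1%:R / a) ^+ n.+1.
apply: (@squeeze_cvgr _ _ _ _ (cst 0) (fun x => c * x^-1)); last 2 first.
- exact: cvg_cst.
- rewrite -(mulr0 c); apply: cvgMl_tmp.
  by apply/gtr0_cvgV0; [exact: nbhs_pinfty_gt|exact: cvg_id].
near=> x.
have x0 : 0 < x by near: x; exact: nbhs_pinfty_gt.
rewrite mulr_ge0 ?exprn_ge0 ?expR_ge0 ?(ltW x0)//= expRN ler_pdivrMr ?expR_gt0//.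
(* From [expR y >= y], raised to the power [n + 1]: one power of [x] more than needed leaves the
   decay [x^-1], and [c] collects the constants. *)
set y := a * x / n.+1%:R.
have y0 : 0 < y by rewrite divr_gt0 ?mulr_gt0.
have -> : expR (a * x) = expR y ^+ n.+1.
  by rewrite -expRM_natl /y mulrCA divff ?mulr1 ?pnatr_eq0.
apply: (@le_trans _ _ (c * x^-1 * y ^+ n.+1)).
  rewrite /c mulrAC -exprMn.
  have -> : n.+1%:R / a * y = x by rewrite /y; field; rewrite nat1r pnatr_eq0 /= gt_eqF.
  by rewrite exprSr mulfK// gt_eqF.
rewrite ler_wpM2l//; first by rewrite mulr_ge0 ?invr_ge0 ?(ltW x0)// exprn_ge0// divr_ge0 ?ltW.
rewrite lerXn2r ?nnegrE ?(ltW y0) ?expR_ge0//.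
by apply: le_trans (expR_ge1Dx _); rewrite lerDr.
Unshelve. all: by end_near. Qed.

(** Repeated integration by parts for [x ^+ n * expR (- a * x)]; for [0 < a] this primitive is the
    one that vanishes at infinity. *)
Fixpoint gamma_primitive (a : R) n (x : R) : R :=
  if n is n'.+1 then
    - a^-1 * (x ^+ n * expR (- a * x)) + n%:R / a * gamma_primitive a n' x
  else - a^-1 * expR (- a * x).

Lemma is_derive_expRM (a x : R) :
  is_derive x 1 (fun y => expR (a * y)) (a * expR (a * x)).
Proof.
have dL : is_derive x 1 (fun y : R => a * y) a.
  rewrite -[X in is_derive _ _ _ X]mulr1.
  exact: (@is_deriveZ _ _ _ id a x 1 1).
rewrite mulrC.
exact: (@is_derive1_comp _ expR (fun y => a * y) x (expR (a * x)) a).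
Qed.

Lemma is_derive_gamma_primitive a n (x : R) : a != 0 ->
  is_derive x 1 (gamma_primitive a n) (x ^+ n * expR (- a * x)).
Proof.
move=> a0; have dE := is_derive_expRM (- a) x.
elim: n => [|n IH].
  have := is_deriveZ (- a^-1) dE.
  by rewrite /GRing.scale/= mulrA mulrNN mulVf// expr0.
have dX : is_derive x 1 (fun y : R => y ^+ n.+1) (n.+1%:R * x ^+ n).
  have := @is_deriveX R R id n.+1 x 1 1 (is_derive_id _ _).
  by rewrite /GRing.scale/= mulr1 exprfctE.
have h := is_deriveD (is_deriveZ (- a^-1) (is_deriveM dX dE)) (is_deriveZ (n.+1%:R / a) IH).
apply: (is_derive_eq h).
rewrite /GRing.scale/= [x ^+ n.+1]exprS.
move: (x ^+ n) (expR _) => u e.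
by field.
Qed.

Lemma is_derive_continuous (F : R -> R) (x df : R) : is_derive x 1 F df ->
  {for x, continuous F}.
Proof.
by move=> dF; apply: differentiable_continuous; apply/derivable1_diffP; exact: ex_derive.
Qed.

Lemma integral_derive_y (F f : R -> R) (l : R) :
    (forall x : R, is_derive x (1 : R) F (f x)) -> continuous f ->
    (forall x, 0 <= x -> 0 <= f x) -> F x @[x --> +oo] --> l ->
  (\int[leb]_(x in `[0%R, +oo[) (f x)%:E = (l - F 0)%:E)%E.
Proof.
move=> dF cf f0 Fl; rewrite (@ge0_continuous_FTC2y _ f F 0 l)//.
- exact: continuous_subspaceT.
- by apply: cvg_at_right_filter; exact: (is_derive_continuous (dF 0)).
- by move=> x _; rewrite derive1E derive_val.
Qed.

Lemma gamma_primitive0 a n : a != 0 -> gamma_primitive a n 0 = - (n`!%:R / a ^+ n.+1).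
Proof.
move=> a0; elim: n => [|n IH] /=; first by rewrite mulr0 expR0 mulr1 fact0 expr1 mul1r.
rewrite IH expr0n/= mul0r mulr0 add0r factS natrM !exprS; field.
by rewrite a0 expf_neq0.
Qed.

Lemma cvg_gamma_primitive_y a n : 0 < a -> gamma_primitive a n x @[x --> +oo] --> (0 : R).
Proof.
move=> a0.
have h m : - a^-1 * (x ^+ m * expR (- a * x)) @[x --> +oo] --> (0 : R).
  rewrite -(mulr0 (- a^-1)); apply: cvgMl_tmp.
  by have := @cvg_expRn_y a m a0; under eq_fun do rewrite -mulNr.
elim: n => [|n IH] /=.
  by have := h 0%N; under eq_fun do rewrite expr0 mul1r.
rewrite -[0]addr0; apply: cvgD; first exact: h.
by rewrite -(mulr0 (n.+1%:R / a)); exact: cvgMl_tmp.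
Qed.

Lemma integral_gamma (a : R) n : 0 < a ->
  (\int[leb]_(x in `[0%R, +oo[) (x ^+ n * expR (- a * x))%:E =
   (n`!%:R / a ^+ n.+1)%:E)%E.
Proof.
move=> a0; have an0 : a != 0 by rewrite gt_eqF.
rewrite (@integral_derive_y _ _ 0 (fun x => is_derive_gamma_primitive n x an0)).
- by rewrite gamma_primitive0// sub0r opprK.
- move=> x; apply: cvgM; first exact: exprn_continuous.
  exact: (is_derive_continuous (is_derive_expRM (- a) x)).
- by move=> x x0; rewrite mulr_ge0 ?exprn_ge0 ?expR_ge0.
- exact: cvg_gamma_primitive_y.
Qed.

(** The integrand is the Gaussian of the plane read in the radial coordinate, up to the factor
    carried by the twisted weight; it serves to compute the constant in [integral_radial]. *)
Lemma integral_expXn (M : nat) : (0 < M)%N ->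
  (\int[leb]_(x in `[0%R, +oo[) (x ^+ M.-1 * expR (- x ^+ M))%:E =
   (M%:R^-1)%:E)%E.
Proof.
case: M => // M _ /=.
have M0 : M.+1%:R != 0 :> R by rewrite pnatr_eq0.
pose F (x : R) := - M.+1%:R^-1 * expR (- x ^+ M.+1).
have dX (x : R) : is_derive x 1 (fun y : R => - y ^+ M.+1) (- (M.+1%:R * x ^+ M)).
  have := @is_deriveX R R id M.+1 x 1 1 (is_derive_id _ _).
  by rewrite /GRing.scale/= mulr1 exprfctE => /is_deriveN.
have dE (x : R) := @is_derive1_comp _ expR _ x _ _ (is_derive_expR _) (dX x).
have dF (x : R) : is_derive x (1 : R) F (x ^+ M * expR (- x ^+ M.+1)).
  apply: (is_derive_eq (is_deriveZ (- M.+1%:R^-1) (dE x))).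
  rewrite /GRing.scale/=; move: (x ^+ M) (expR _) => u e.
  by field; rewrite nat1r.
rewrite (@integral_derive_y _ _ 0 dF).
- by rewrite /F expr0n/= oppr0 expR0 mulr1 sub0r opprK.
- move=> x; apply: cvgM; first exact: exprn_continuous.
  exact: (is_derive_continuous (dE x)).
- by move=> x x0; rewrite mulr_ge0 ?exprn_ge0 ?expR_ge0.
- rewrite -(mulr0 (- M.+1%:R^-1)); apply: cvgMl_tmp.
  apply: (@squeeze_cvgr _ _ _ _ (cst 0) (fun x => expR (- x))).
  + near=> x; rewrite expR_ge0/= ler_expR lerN2.
    have x1 : 1 <= x by near: x; exact: nbhs_pinfty_ge.
    by rewrite exprS ler_peMr ?exprn_ege1// (le_trans _ x1).
  + exact: cvg_cst.
  + exact: cvgr_expR.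
Unshelve. all: by end_near. Qed.

End exponential_integrals.

(** * The twisted weight in the radial coordinate *)

Section radial.
Variables (R : realType) (M : nat).
Hypothesis M0 : (0 < M)%N.
Local Notation m := (@plane_lebesgue R).
Local Notation leb := (@lebesgue_measure R).

Definition radial_coord (z : plane R) : R := modulus z `^ (2 / M%:R).

Definition twisted_weight (z : plane R) : R := modulus z `^ (2 / M%:R - 2).

Lemma measurable_radial_coord : measurable_fun setT radial_coord.
Proof. exact: (measurableT_comp (measurable_powR _) (@measurable_modulus R)). Qed.

Lemma measurable_twisted_weight : measurable_fun setT twisted_weight.
Proof. exact: (measurableT_comp (measurable_powR _) (@measurable_modulus R)). Qed.

Let MR0 : (M%:R : R) != 0. Proof. by rewrite pnatr_eq0 -lt0n. Qed.

Lemma radial_coord_powM z : radial_coord z ^+ M = modulus z ^+ 2.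
Proof.
rewrite -!powR_mulrn ?powR_ge0 ?modulus_ge0// /radial_coord -powRrM.
by rewrite divfK.
Qed.

Lemma radial_coord_scale (l : R) z : 0 < l ->
  radial_coord (plane_dilate (l `^ (M%:R / 2)) z) = l * radial_coord z.
Proof.
move=> l0; rewrite /radial_coord modulus_dilate ?powR_ge0//.
rewrite powRM ?powR_ge0 ?modulus_ge0// -powRrM.
by rewrite [X in l `^ X](_ : _ = 1) ?powRr1 ?ltW//; field.
Qed.

(** The squared factor is the Jacobian of the dilation. The exponents of [l] add up to
    [M + (M / 2) (2 / M - 2) = 1], which is the homogeneity required by [homogeneous_measureE]. *)
Lemma twisted_weight_scale (l : R) z : 0 < l ->
  (l `^ (M%:R / 2)) ^+ 2 * twisted_weight (plane_dilate (l `^ (M%:R / 2)) z) =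
  l * twisted_weight z.
Proof.
move=> l0; rewrite /twisted_weight modulus_dilate ?powR_ge0//.
rewrite powRM ?powR_ge0 ?modulus_ge0// mulrA; congr (_ * _).
rewrite -powR_mulrn ?powR_ge0// -!powRrM -powRD; last by rewrite (gt_eqF l0) implybT.
by rewrite [X in l `^ X](_ : _ = 1) ?powRr1 ?ltW//; field.
Qed.

Local Open Scope ereal_scope.

Lemma integral_radial_scale (l : R) (g : R -> \bar R) : (0 < l)%R ->
    measurable_fun setT g -> (forall x, 0 <= g x) ->
  \int[m]_z (g (radial_coord z) * (twisted_weight z)%:E) =
  l%:E * \int[m]_z (g (l * radial_coord z)%R * (twisted_weight z)%:E).
Proof.
move=> l0 mg g0; set s := (l `^ (M%:R / 2))%R.
have s0 : (0 < s)%R by rewrite powR_gt0.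
rewrite (@integral_dilate _ s _ s0); last 2 first.
- apply: emeasurable_funM.
    exact: (measurableT_comp mg measurable_radial_coord).
  by apply/measurable_EFinP; exact: measurable_twisted_weight.
- by move=> z; rewrite mule_ge0// lee_fin powR_ge0.
have mgl : measurable_fun setT (fun z => g (l * radial_coord z)%R).
  apply: (measurableT_comp mg).
  by apply: measurable_funM => //; exact: measurable_radial_coord.
have mw : measurable_fun setT (EFin \o twisted_weight).
  by apply/measurable_EFinP; exact: measurable_twisted_weight.
have w0 z : 0 <= (twisted_weight z)%:E by rewrite lee_fin powR_ge0.
have mdl := measurable_plane_dilate s.
transitivity (\int[m]_z ((s ^+ 2)%:E *
    (g (radial_coord (plane_dilate s z)) * (twisted_weight (plane_dilate s z))%:E))).
  apply/esym/ge0_integralZl => //.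
  - apply: emeasurable_funM.
      exact: (measurableT_comp mg (measurableT_comp measurable_radial_coord mdl)).
    exact: (measurableT_comp mw mdl).
  - by move=> z _; rewrite mule_ge0.
  - by rewrite lee_fin sqr_ge0.
transitivity (\int[m]_z (l%:E * (g (l * radial_coord z)%R * (twisted_weight z)%:E))); last first.
  apply: ge0_integralZl => //.
  - exact: emeasurable_funM.
  - by move=> z _; rewrite mule_ge0.
  - by rewrite lee_fin ltW.
apply: eq_integral => z _.
rewrite radial_coord_scale// muleCA -EFinM twisted_weight_scale//.
by rewrite EFinM muleCA.
Qed.

(** The image of the weighted measure under [radial_coord] satisfies the hypotheses of
    [homogeneous_measureE]; one test function with known integrals on both sides then gives the
    constant. *)
Lemma integral_radial (g : R -> \bar R) :
    measurable_fun setT g -> (forall x, 0 <= g x) ->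
  \int[m]_z (g (radial_coord z) * (twisted_weight z)%:E) =
  (pi * M%:R)%:E * \int[leb]_(x in `[0%R, +oo[) g x.
Proof.
have w0 z : (0 <= twisted_weight z)%R by exact: powR_ge0.
have [nu nuE] := @exists_density_measure _ _ _ m _ measurable_twisted_weight w0.
pose rad : plane R -> measurableTypeR R := radial_coord.
have mrad : measurable_fun setT rad by exact: measurable_radial_coord.
pose mu' : {measure set (measurableTypeR R) -> \bar R} := pushforward nu rad.
pose mu := mu' mrad.
have muE g' : measurable_fun setT g' -> (forall x, 0 <= g' x) ->
    \int[mu]_x g' x = \int[m]_z (g' (radial_coord z) * (twisted_weight z)%:E).
  move=> mg' g'0.
  have := ge0_integral_pushforward mrad nu measurableT mg' (fun x _ => g'0 x).
  rewrite preimage_setT => h; apply: (etrans h).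
  by apply: nuE; [exact: (measurableT_comp mg' mrad)|move=> z; exact: g'0].
have muA (A : set (measurableTypeR R)) : measurable A ->
    mu A = \int[m]_z ((\1_A (radial_coord z))%:E * (twisted_weight z)%:E).
  move=> mA; transitivity (\int[mu]_x (\1_A x)%:E).
    by rewrite integral_indic// setIT.
  apply: (muE (fun x => (\1_A x)%:E)) => //.
  by apply/measurable_EFinP; exact: measurable_indic.
(* Chosen so that [G (radial_coord z)] times the twisted weight is [expR (- modulus z ^+ 2)]: the
   remaining powers of the modulus cancel. Absolute values make it nonnegative on the whole line. *)
pose G (x : R) : R := (`|x| ^+ M.-1 * expR (- `|x| ^+ M))%R.
have mG : measurable_fun setT (EFin \o G).
  apply/measurable_EFinP; apply: measurable_funM.
    by apply: measurable_funX; exact: normr_measurable.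
  apply: measurableT_comp => //; apply: measurable_funN.
  by apply: measurable_funX; exact: normr_measurable.
have G0 x : 0 <= (EFin \o G) x by rewrite lee_fin mulr_ge0 ?exprn_ge0 ?expR_ge0.
have HG : \int[m]_z ((G (radial_coord z))%:E * (twisted_weight z)%:E) = pi%:E.
  rewrite -integral_gauss_plane; apply: ge0_ae_eq_integral => //.
  - apply: emeasurable_funM; first exact: (measurableT_comp mG measurable_radial_coord).
    by apply/measurable_EFinP; exact: measurable_twisted_weight.
  - apply/measurable_EFinP; apply: measurableT_comp => //.
    by apply: measurable_funN; apply: measurable_funX; exact: measurable_modulus.
  - by move=> z _; apply: mule_ge0; [exact: (G0 (radial_coord z))|rewrite lee_fin].
  apply: ae_modulus_neq0 => z mz _.
  rewrite /G ger0_norm ?powR_ge0// radial_coord_powM -EFinM mulrAC.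
  suff -> : (radial_coord z ^+ M.-1 * twisted_weight z = 1)%R by rewrite mul1r.
  rewrite -powR_mulrn ?powR_ge0// /radial_coord /twisted_weight -powRrM -powRD ?mz ?implybT//.
  rewrite [X in powR _ X](_ : _ = 0)%R ?powRr0//.
  by rewrite -subn1 natrB//; field.
have ind01 (A : set (measurableTypeR R)) : measurable A ->
    measurable_fun setT (fun x : R => (\1_A x)%:E : \bar R).
  by move=> mA; apply/measurable_EFinP; exact: measurable_indic.
have mu_neg : mu (`]-oo, 0%R]%classic : set (measurableTypeR R)) = 0.
  rewrite muA; last exact: measurable_itv.
  rewrite (ge0_ae_eq_integral (g := cst 0)) ?integral0//.
  - apply: emeasurable_funM.
      apply: (measurableT_comp (ind01 _ _) measurable_radial_coord).
      exact: measurable_itv.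
    by apply/measurable_EFinP; exact: measurable_twisted_weight.
  - by move=> z _; rewrite mule_ge0// lee_fin.
  apply: ae_modulus_neq0 => z mz _.
  rewrite indicE memNset ?mul0e//= in_itv/=; apply/negP; rewrite -ltNge.
  by rewrite powR_gt0// lt_neqAle modulus_ge0 eq_sym mz.
have mu_scale (l a b : R) : (0 < l)%R ->
   mu (`](l * a)%R, (l * b)%R]%classic : set (measurableTypeR R)) = l%:E * mu `]a, b]%classic.
  move=> l0; rewrite !muA; try exact: measurable_itv.
  rewrite (@integral_radial_scale l (fun x => (\1_(`](l * a)%R, (l * b)%R]%classic) x)%:E))//; last first.
    by apply: ind01; exact: measurable_itv.
  congr (_ * _); apply: eq_integral => z _; congr (_%:E * _).
  rewrite !indicE; congr ((nat_of_bool _)%:R).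
  by apply/idP/idP; rewrite !inE/= !in_itv/= ltr_pM2l// ler_pM2l.
have mu_fin : mu (`](2^-1)%R, 1%R]%classic : set (measurableTypeR R)) < +oo.
  (* A lower bound of [G] on [(1/2, 1]], so that the mass of this interval is at most [pi / e]. *)
  pose e : R := ((2^-1) ^+ M.-1 * expR (- 1))%R.
  have e0 : (0 < e)%R by rewrite mulr_gt0 ?expR_gt0 ?exprn_gt0 ?invr_gt0.
  suff : e%:E * mu (`](2^-1)%R, 1%R]%classic : set (measurableTypeR R)) < +oo.
    by apply: contraTT; rewrite -!leNgt !leye_eq => /eqP ->; rewrite gt0_muley ?lte_fin.
  apply: (@le_lt_trans _ _ (\int[mu]_x (G x)%:E)); last first.
    by rewrite (muE (EFin \o G))// HG ltry.
  rewrite -[X in mu X]setIT -integral_indic//.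
  rewrite -ge0_integralZl//; last 2 first.
  - by apply: ind01; exact: measurable_itv.
  - by rewrite lee_fin ltW.
  apply: ge0_le_integral => //.
  - by move=> x _; rewrite mule_ge0// lee_fin ?ltW.
  - by apply: emeasurable_funM => //; apply: ind01; exact: measurable_itv.
  move=> x _; rewrite indicE.
  have [|_] := boolP (x \in _); last by rewrite mule0; exact: G0.
  rewrite inE/= in_itv/= mule1 lee_fin => /andP[x1 x2].
  have x0 : (0 < x)%R by rewrite (lt_trans _ x1)// invr_gt0.
  rewrite /e /G ger0_norm ?(ltW x0)// ler_pM ?exprn_ge0 ?expR_ge0 ?invr_ge0//.
    by rewrite lerXn2r ?nnegrE ?invr_ge0 ?(ltW x0) ?(ltW x1).
  by rewrite ler_expR lerN2 exprn_ile1// ltW.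
have [c c0 cE] := homogeneous_measureE mu_neg mu_scale mu_fin.
have cpi : c = (pi * M%:R)%R.
  have := cE _ mG G0; rewrite (muE (EFin \o G))// HG.
  have -> : \int[leb]_(x in `[0%R, +oo[) (EFin \o G) x =
      \int[leb]_(x in `[0%R, +oo[) (x ^+ M.-1 * expR (- x ^+ M))%:E.
    apply: eq_integral => x; rewrite inE/= in_itv/= andbT => x0.
    by rewrite /G ger0_norm.
  rewrite integral_expXn// -EFinM => -[->].
  by rewrite divfK.
by move=> mg g0; rewrite -muE// cE// cpi.
Qed.

End radial.

(** * Complex integrals and Andreief's identity *)

Section real_integrable.
Context d (T : measurableType d) (R : realType) (mu : {measure set T -> \bar R}).
Implicit Types u v f : T -> R.

Lemma integrable_EFinD u v : mu.-integrable setT (EFin \o u) ->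
  mu.-integrable setT (EFin \o v) -> mu.-integrable setT (EFin \o (fun x => u x + v x)).
Proof. by move=> iu iv; have := integrableD measurableT iu iv; apply: eq_integrable. Qed.

Lemma integrable_EFinB u v : mu.-integrable setT (EFin \o u) ->
  mu.-integrable setT (EFin \o v) -> mu.-integrable setT (EFin \o (fun x => u x - v x)).
Proof. by move=> iu iv; have := integrableB measurableT iu iv; apply: eq_integrable. Qed.

Lemma integrable_EFinZl r u : mu.-integrable setT (EFin \o u) ->
  mu.-integrable setT (EFin \o (fun x => r * u x)).
Proof. by move=> iu; have := integrableZl measurableT r iu; apply: eq_integrable. Qed.

Lemma integrable_bounded_mul u f B : mu.-integrable setT (EFin \o u) ->
  measurable_fun setT f -> (forall x, `|f x| <= B) ->
  mu.-integrable setT (EFin \o (fun x => u x * f x)).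
Proof.
move=> iu mf fB; have ig := integrableZl measurableT B iu.
have mu' : measurable_fun setT u by apply/measurable_EFinP; case/integrableP : iu.
apply: le_integrable ig => //.
  by apply/measurable_EFinP; exact: measurable_funM.
move=> x _; rewrite -EFinM /= lee_fin !normrM [leRHS]mulrC ler_wpM2l//.
by rewrite (le_trans (fB x))// ler_norm.
Qed.

End real_integrable.

Section complex_integral.
Context d (T : measurableType d) (R : realType) (mu : {measure set T -> \bar R}).
Local Notation C := R[i].
Implicit Types F G : T -> C.

Definition cintegrable F : Prop :=
  mu.-integrable setT (fun x => (complex.Re (F x))%:E) /\
  mu.-integrable setT (fun x => (complex.Im (F x))%:E).

Definition cint F : C :=
  Complex (\int[mu]_x complex.Re (F x)) (\int[mu]_x complex.Im (F x)).

Lemma cintegrableD F G : cintegrable F -> cintegrable G ->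
  cintegrable (fun x => F x + G x).
Proof.
move=> [F1 F2] [G1 G2]; split.
  under eq_fun do rewrite raddfD/= EFinD; exact: integrableD.
under eq_fun do rewrite raddfD/= EFinD; exact: integrableD.
Qed.

Lemma cintD F G : cintegrable F -> cintegrable G ->
  cint (fun x => F x + G x) = cint F + cint G.
Proof.
move=> [F1 F2] [G1 G2]; rewrite /cint; congr Complex.
  by under eq_Rintegral do rewrite raddfD; rewrite RintegralD.
by under eq_Rintegral do rewrite raddfD; rewrite RintegralD.
Qed.

Lemma cintegrable0 : cintegrable (fun=> 0).
Proof. by split; exact: integrable0. Qed.

Lemma cint0 : cint (fun=> 0) = 0.
Proof. by rewrite /cint !Rintegral_cst// !mul0r. Qed.

Lemma cintegrableZ (a : C) F : cintegrable F -> cintegrable (fun x => a * F x).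
Proof.
case: a => a b [F1 F2]; split.
  have -> : (fun x => (complex.Re (Complex a b * F x))%:E) =
     (fun x => a%:E * (complex.Re (F x))%:E - b%:E * (complex.Im (F x))%:E)%E.
    by apply/funext => x; case: (F x) => u v; rewrite /= -!EFinM -EFinB.
  by apply: integrableB => //; exact: integrableZl.
have -> : (fun x => (complex.Im (Complex a b * F x))%:E) =
   (fun x => a%:E * (complex.Im (F x))%:E + b%:E * (complex.Re (F x))%:E)%E.
  by apply/funext => x; case: (F x) => u v; rewrite /= -!EFinM -EFinD.
by apply: integrableD => //; exact: integrableZl.
Qed.

Lemma cintZ (a : C) F : cintegrable F -> cint (fun x => a * F x) = a * cint F.
Proof.
case: a => a b [F1 F2]; rewrite /cint [RHS]/=.
congr Complex.
  transitivity (\int[mu]_x (a * complex.Re (F x) - b * complex.Im (F x))).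
    by apply: eq_Rintegral => x _; case: (F x).
  by rewrite RintegralB ?RintegralZl//; exact: integrable_EFinZl.
transitivity (\int[mu]_x (a * complex.Im (F x) + b * complex.Re (F x))).
  by apply: eq_Rintegral => x _; case: (F x).
by rewrite RintegralD ?RintegralZl//; exact: integrable_EFinZl.
Qed.

Lemma cintegrable_sum I (s : seq I) (F : I -> T -> C) :
  (forall i, cintegrable (F i)) -> cintegrable (fun x => \sum_(i <- s) F i x).
Proof.
move=> h; elim: s => [|i s IH].
  by under eq_fun do rewrite big_nil; exact: cintegrable0.
by under eq_fun do rewrite big_cons; exact: cintegrableD.
Qed.

Lemma cint_sum I (s : seq I) (F : I -> T -> C) :
  (forall i, cintegrable (F i)) ->
  cint (fun x => \sum_(i <- s) F i x) = \sum_(i <- s) cint (F i).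
Proof.
move=> h; elim: s => [|i s IH].
  by rewrite big_nil; under eq_fun do rewrite big_nil; exact: cint0.
rewrite big_cons -IH -cintD//; last exact: cintegrable_sum.
by under eq_fun do rewrite big_cons.
Qed.

Lemma cintegrable_real (f : T -> R) : cintegrable (fun x => (f x)%:C%C) <->
  mu.-integrable setT (EFin \o f).
Proof. by split => [[]//|fi]; split => //; exact: integrable0. Qed.

Lemma cint_real (f : T -> R) : cint (fun x => (f x)%:C%C) = (\int[mu]_x f x)%:C%C.
Proof. by rewrite /cint Rintegral_cst// mul0r. Qed.

Lemma conj_complex (z : C) : z^* = Complex (complex.Re z) (- complex.Im z).
Proof. by case: z. Qed.

Lemma cint_conj F : cintegrable F -> cint (fun x => (F x)^*) = (cint F)^*.
Proof.
move=> [F1 F2]; rewrite conj_complex /cint/=; congr Complex.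
  by apply: eq_Rintegral => x _; rewrite conj_complex.
rewrite -mulN1r -RintegralZl//.
by apply: eq_Rintegral => x _; rewrite conj_complex/= mulN1r.
Qed.

Lemma cint_ge0 F : (forall x, 0 <= F x) -> 0 <= cint F.
Proof.
move=> F0; have Fr x : F x = (complex.Re (F x))%:C%C.
  by rewrite [LHS]complexE (ger0_Im (F0 x)) mulr0 addr0.
have -> : F = (fun x => (complex.Re (F x))%:C%C) by apply/funext.
rewrite cint_real ler0c; apply: Rintegral_ge0 => x _.
by have := F0 x; rewrite [in X in X -> _]Fr ler0c.
Qed.

End complex_integral.

Section product_integral.
Context d1 d2 (T1 : measurableType d1) (T2 : measurableType d2) (R : realType).
Variables (m1 : {sigma_finite_measure set T1 -> \bar R})
          (m2 : {sigma_finite_measure set T2 -> \bar R}).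
Local Notation m12 := ((m1 \x m2)%E : {measure set (T1 * T2) -> \bar R}).

Lemma integrable_tensor (f : T1 -> R) (g : T2 -> R) :
  m1.-integrable setT (EFin \o f) -> m2.-integrable setT (EFin \o g) ->
  m12.-integrable setT (fun z => (f z.1 * g z.2)%:E).
Proof.
move=> fi gi.
have mf : measurable_fun setT f by apply/measurable_EFinP; exact: measurable_int fi.
have mg : measurable_fun setT g by apply/measurable_EFinP; exact: measurable_int gi.
apply/integrable12ltyP.
  apply/measurable_EFinP; apply: measurable_funM.
    exact: (measurableT_comp mf measurable_fst).
  exact: (measurableT_comp mg measurable_snd).
under eq_integral => x _.
  under eq_integral => y _ do rewrite /= normrM EFinM.
  rewrite ge0_integralZl//; last by apply/measurable_EFinP; exact: measurableT_comp.
  over.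
have mf' : measurable_fun setT (fun x => `|f x|%:E).
  by apply/measurable_EFinP; exact: measurableT_comp.
rewrite ge0_integralZr//; last exact: integral_ge0.
move/integrableP : fi => [_ fi]; move/integrableP : gi => [_ gi].
by rewrite lte_mul_pinfty ?integral_ge0// ge0_fin_numE ?integral_ge0.
Qed.

Lemma Rintegral_tensor (f : T1 -> R) (g : T2 -> R) :
  m1.-integrable setT (EFin \o f) -> m2.-integrable setT (EFin \o g) ->
  \int[m12]_z (f z.1 * g z.2) = (\int[m1]_x f x) * (\int[m2]_y g y).
Proof.
move=> fi gi; have fgi := integrable_tensor fi gi.
have If := integrable_fin_num measurableT fi.
have Ig := integrable_fin_num measurableT gi.
rewrite /Rintegral -(integral12_prod_meas1 fgi) /fubini_F/=.
under eq_integral => x _.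
  under eq_integral => y _ do rewrite EFinM.
  rewrite integralZl// -(fineK Ig); over.
rewrite integralZr// -(fineK If) -EFinM.
by [].
Qed.

Local Open Scope ring_scope.

Lemma cintegrable_tensor (F : T1 -> R[i]) (G : T2 -> R[i]) :
  cintegrable m1 F -> cintegrable m2 G ->
  cintegrable m12 (fun z => F z.1 * G z.2).
Proof.
move=> [F1 F2] [G1 G2]; split.
  apply: (eq_integrable _ (fun z => (complex.Re (F z.1) * complex.Re (G z.2))%:E -
     (complex.Im (F z.1) * complex.Im (G z.2))%:E)%E) => //.
    by move=> z _; case: (F z.1) => a b; case: (G z.2) => a' b'; rewrite -EFinB.
  apply: integrableB => //.
    exact: (@integrable_tensor (complex.Re (R:=R) \o F) (complex.Re (R:=R) \o G)).
  exact: (@integrable_tensor (complex.Im (R:=R) \o F) (complex.Im (R:=R) \o G)).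
apply: (eq_integrable _ (fun z => (complex.Re (F z.1) * complex.Im (G z.2))%:E +
     (complex.Im (F z.1) * complex.Re (G z.2))%:E)%E) => //.
  by move=> z _; case: (F z.1) => a b; case: (G z.2) => a' b'; rewrite -EFinD.
apply: integrableD => //.
  exact: (@integrable_tensor (complex.Re (R:=R) \o F) (complex.Im (R:=R) \o G)).
exact: (@integrable_tensor (complex.Im (R:=R) \o F) (complex.Re (R:=R) \o G)).
Qed.

Lemma cint_tensor (F : T1 -> R[i]) (G : T2 -> R[i]) :
  cintegrable m1 F -> cintegrable m2 G ->
  cint m12 (fun z => F z.1 * G z.2) = cint m1 F * cint m2 G.
Proof.
move=> [F1 F2] [G1 G2]; rewrite {1}/cint.
transitivity (Complex
  (\int[m12]_z (complex.Re (F z.1) * complex.Re (G z.2) -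
                complex.Im (F z.1) * complex.Im (G z.2)))
  (\int[m12]_z (complex.Re (F z.1) * complex.Im (G z.2) +
                complex.Im (F z.1) * complex.Re (G z.2)))).
  by congr Complex; apply: eq_Rintegral => z _; case: (F z.1); case: (G z.2).
rewrite RintegralB ?RintegralD//.
- rewrite (@Rintegral_tensor (complex.Re (R:=R) \o F) (complex.Re (R:=R) \o G))//.
  rewrite (@Rintegral_tensor (complex.Im (R:=R) \o F) (complex.Im (R:=R) \o G))//.
  rewrite (@Rintegral_tensor (complex.Re (R:=R) \o F) (complex.Im (R:=R) \o G))//.
  by rewrite (@Rintegral_tensor (complex.Im (R:=R) \o F) (complex.Re (R:=R) \o G)).
- exact: (@integrable_tensor (complex.Re (R:=R) \o F) (complex.Im (R:=R) \o G)).
- exact: (@integrable_tensor (complex.Im (R:=R) \o F) (complex.Re (R:=R) \o G)).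
- exact: (@integrable_tensor (complex.Re (R:=R) \o F) (complex.Re (R:=R) \o G)).
- exact: (@integrable_tensor (complex.Im (R:=R) \o F) (complex.Im (R:=R) \o G)).
Qed.

End product_integral.

Section power_integral.
Context d (T : measurableType d) (R : realType).
Variable mu : {sigma_finite_measure set T -> \bar R}.

Let uncons n (t : n.+1.-tuple T) : T * n.-tuple T := (thead t, [tuple of behead t]).

Let measurable_uncons n : measurable_fun setT (@uncons n).
Proof.
apply/measurable_fun_pair => //=; [exact: measurable_tnth|exact: measurable_behead].
Qed.

Let consK n (t : n.+1.-tuple T) : cons_pair (uncons t) = t.
Proof. by rewrite [RHS]tuple_eta; exact/val_inj. Qed.

Lemma power_cons_integral n (f : n.+1.-tuple T -> \bar R) :
    (mu \x power_measure mu n)%E.-integrable setT (f \o @cons_pair _ T n) ->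
  (power_measure mu n.+1).-integrable setT f /\
  (\int[power_measure mu n.+1]_t f t =
   \int[(mu \x power_measure mu n)]_z (f (cons_pair z)))%E.
Proof.
move=> fi; have mf : measurable_fun setT f.
  have -> : f = (f \o @cons_pair _ T n) \o @uncons n.
    by apply/funext => t /=; rewrite consK.
  apply: measurableT_comp; last exact: measurable_uncons.
  by case/integrableP : fi.
split; first exact: (integrable_pushforward (@measurable_cons_pair _ T n) mf fi measurableT).
transitivity (\int[pushforward (mu \x power_measure mu n) (@cons_pair _ T n)]_t f t)%E.
  by apply: eq_measure_integral => //; exact: measurable_cons_pair.
exact: (integral_pushforward (@measurable_cons_pair _ T n) mf fi measurableT).
Qed.

(** Fubini for products of one-variable functions, one coordinate at a time through [cons_pair]. *)
Lemma cintegral_prod_power n (F : 'I_n -> T -> R[i]) :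
  (forall i, cintegrable mu (F i)) ->
  cintegrable (power_measure mu n) (fun t => \prod_(i < n) F i (tnth t i)) /\
  cint (power_measure mu n) (fun t => \prod_(i < n) F i (tnth t i)) =
    \prod_(i < n) cint mu (F i).
Proof.
elim: n F => [|n IH] F iF.
  have -> : (fun t => \prod_(i < 0) F i (tnth t i)) = (fun=> (1 : R)%:C%C).
    by apply/funext => t; rewrite big_ord0.
  rewrite big_ord0 cint_real; split.
    apply/cintegrable_real; apply: finite_measure_integrable_cst => //.
  by rewrite /Rintegral integral_dirac// diracE in_setT mul1e.
have [iG IG] := IH (fun i => F (lift ord0 i)) (fun i => iF _).
have E z : \prod_(i < n.+1) F i (tnth (cons_pair z) i) =
    F ord0 z.1 * \prod_(i < n) F (lift ord0 i) (tnth z.2 i).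
  case: z => x t /=; rewrite big_ord_recl tnth0; congr (_ * _).
  by apply: eq_bigr => i _; rewrite tnthS.
have [i1 i2] := cintegrable_tensor (iF ord0) iG.
have IT := cint_tensor (iF ord0) iG; rewrite [X in _ /\ _ = X]big_ord_recl -IG -IT.
have [] := @power_cons_integral n
    (fun t => (complex.Re (\prod_(i < n.+1) F i (tnth t i)))%:E).
  by apply: eq_integrable i1 => // z _ /=; rewrite E.
move=> j1 e1.
have [] := @power_cons_integral n
    (fun t => (complex.Im (\prod_(i < n.+1) F i (tnth t i)))%:E).
  by apply: eq_integrable i2 => // z _ /=; rewrite E.
move=> j2 e2; split => //.
rewrite /cint /Rintegral e1 e2; congr (Complex (fine _) (fine _));
  by apply: eq_integral => z _; rewrite E.
Qed.

End power_integral.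

Section andreief.
Context d (T : measurableType d) (R : realType).
Variable mu : {sigma_finite_measure set T -> \bar R}.
Local Notation C := R[i].
Variables (n : nat) (phi : 'I_n -> T -> C) (W : T -> R).

Definition gram_entry (a b : 'I_n) : C :=
  cint mu (fun x => phi a x * (phi b x)^* * (W x)%:C%C).

Definition gram : 'M[C]_n := \matrix_(a, b) gram_entry a b.

Definition det_weight (t : n.-tuple T) : C :=
  let D := \det (\matrix_(i, j) phi j (tnth t i)) in
  D * D^* * \prod_(i < n) (W (tnth t i))%:C%C.

Hypothesis iF : forall a b,
  cintegrable mu (fun x => phi a x * (phi b x)^* * (W x)%:C%C).

(** Expand both determinants over permutations [s] and [u]. Each term is a product of functions of
    single coordinates, so its integral is a product of Gram entries. *)
Lemma andreief : cintegrable (power_measure mu n) det_weight /\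
  cint (power_measure mu n) det_weight = n`!%:R * \det gram.
Proof.
pose F (s u : 'S_n) i x := phi (s i) x * (phi (u i) x)^* * (W x)%:C%C.
pose h (s u : 'S_n) t : C := (-1) ^+ s * ((-1) ^+ u * \prod_(i < n) F s u i (tnth t i)).
have E : det_weight = fun t => \sum_s \sum_u h s u t.
  apply/funext => t; rewrite /det_weight /=.
  set A := \matrix_(i, j) _.
  have dC : (\det A)^* = \sum_(u : 'S_n) (-1) ^+ u * \prod_i (phi (u i) (tnth t i))^*.
    rewrite rmorph_sum; apply: eq_bigr => u _.
    rewrite rmorphM rmorph_sign rmorph_prod; congr (_ * _).
    by apply: eq_bigr => i _; rewrite mxE.
  rewrite dC /determinant mulr_suml mulr_suml; apply: eq_bigr => s _.
  rewrite mulr_sumr mulr_suml; apply: eq_bigr => u _.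
  rewrite /h /F !big_split/= (eq_bigr (fun i => phi (s i) (tnth t i))); last first.
    by move=> i _; rewrite mxE.
  move: ((-1) ^+ s) ((-1) ^+ u) (\prod_i phi (s i) _) (\prod_i (phi (u i) _)^*)
    (\prod_(i < n) (W _)%:C%C) => e1 e2 p1 p2 p3.
  by rewrite -!mulrA [p1 * (e2 * _)]mulrCA.
have ih s u : cintegrable (power_measure mu n) (h s u).
  apply: cintegrableZ; apply: cintegrableZ.
  by have [] := @cintegral_prod_power _ _ _ mu n (F s u) (fun i => iF _ _).
have Ih s u : cint (power_measure mu n) (h s u) =
    (-1) ^+ s * ((-1) ^+ u * \prod_i gram_entry (s i) (u i)).
  have [i1 e1] := @cintegral_prod_power _ _ _ mu n (F s u) (fun i => iF _ _).
  by rewrite cintZ ?cintZ ?e1//; exact: cintegrableZ.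
rewrite E; split; first by apply: cintegrable_sum => s; exact: cintegrable_sum.
rewrite cint_sum; last by move=> s; exact: cintegrable_sum.
under eq_bigr => s _ do rewrite cint_sum//.
(* For fixed [s] the sum over [u] is the determinant of the Gram matrix with rows permuted by [s];
   its sign cancels the sign of [s], so all [n!] permutations contribute equally. *)
have detr (s : 'S_n) : \sum_(u : 'S_n) cint (power_measure mu n) (h s u) = \det gram.
  under eq_bigr do rewrite Ih.
  rewrite -mulr_sumr.
  have -> : \sum_(u : 'S_n) (-1) ^+ u * \prod_i gram_entry (s i) (u i) =
      \det (row_perm s gram).
    by apply: eq_bigr => u _; congr (_ * _); apply: eq_bigr => i _; rewrite !mxE.
  by rewrite row_permE det_mulmx det_perm mulrA -signr_addb addbb mul1r.
under eq_bigr do rewrite detr.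
by rewrite sumr_const card_Sn mulr_natl.
Qed.

Lemma hermitian_gram : herm_mx gram.
Proof.
move=> a b; rewrite !mxE /gram_entry -cint_conj//; congr cint.
apply/funext => x; rewrite [RHS]rmorphM [X in _ = X * _]rmorphM /= conjCK.
by rewrite [((W x)%:C%C)^*]conj_complex/= oppr0 [(phi a x)^* * _]mulrC.
Qed.

(** The quadratic form at [x] is the integral of [|sum_i x_i phi_i|^2 W]. *)
Lemma psd_gram : (forall x, 0 <= W x) -> psd_mx gram.
Proof.
move=> W0 x; rewrite /quad_form.
have -> : \sum_i \sum_j x i * (x j)^* * gram i j =
   cint mu (fun y => \sum_i \sum_j x i * (x j)^* * (phi i y * (phi j y)^* * (W y)%:C%C)).
  rewrite cint_sum => [|i]; last by apply: cintegrable_sum => j; exact: cintegrableZ.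
  apply: eq_bigr => i _; rewrite cint_sum => [|j]; last exact: cintegrableZ.
  by apply: eq_bigr => j _; rewrite cintZ// mxE.
apply: cint_ge0 => y.
have -> : \sum_i \sum_j x i * (x j)^* * (phi i y * (phi j y)^* * (W y)%:C%C) =
  (\sum_i x i * phi i y) * (\sum_i x i * phi i y)^* * (W y)%:C%C.
  rewrite rmorph_sum mulr_suml mulr_suml; apply: eq_bigr => i _.
  rewrite mulr_sumr mulr_suml; apply: eq_bigr => j _.
  by rewrite rmorphM/=; ring.
by rewrite mulr_ge0 ?mul_conjC_ge0// ler0c.
Qed.

End andreief.

(** * The partition function *)

Section site_weight.
Variables (R : realType) (N M k : nat).
Hypotheses (hkM : (1 <= k <= M)%N) (N0 : (0 < N)%N).
Local Notation m := (@plane_lebesgue R).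

Let M0 : (0 < M)%N. Proof. by case/andP: hkM => k1; exact: leq_trans. Qed.
Let MR0 : (M%:R : R) != 0. Proof. by rewrite pnatr_eq0 -lt0n. Qed.
Let NR0 : 0 < (N%:R : R). Proof. by rewrite ltr0n. Qed.

Definition site_weight (z : plane R) : R :=
  modulus z `^ (2 * (k%:R - M%:R) / M%:R) *
  expR (- (N%:R * modulus z `^ (2 / M%:R))).

(** [pi M Gamma(k + M l) / N^(k + M l)], which [integral_site_norm] identifies as the total mass of
    [|z|^(2 l)] times the site weight. *)
Definition site_norm (l : nat) : R :=
  pi * M%:R * ((k.-1 + M * l)`!%:R / N%:R ^+ (k + M * l)).

Lemma site_norm_gt0 l : 0 < site_norm l.
Proof.
apply: mulr_gt0; first by rewrite mulr_gt0 ?pi_gt0 ?ltr0n.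
by rewrite divr_gt0 ?exprn_gt0 ?ltr0n ?fact_gt0.
Qed.

Lemma site_weight_ge0 z : 0 <= site_weight z.
Proof. by rewrite mulr_ge0 ?powR_ge0 ?expR_ge0. Qed.

Lemma measurable_site_weight : measurable_fun setT site_weight.
Proof.
apply: measurable_funM.
  exact: (measurableT_comp (measurable_powR _) (@measurable_modulus R)).
apply: (measurableT_comp (@measurable_expR R)); apply: measurable_funN.
apply: measurable_funM => //.
exact: (measurableT_comp (measurable_powR _) (@measurable_modulus R)).
Qed.

(** Both sides carry the power [2 l + 2 k / M - 2] of the modulus. The index is [k.-1] rather than
    [k] because one power of the radial coordinate goes into the twisted weight. *)
Lemma site_weight_radial l z : modulus z != 0 ->
  modulus z ^+ (2 * l) * site_weight z =
  radial_coord M z ^+ (k.-1 + M * l) * expR (- N%:R * radial_coord M z) *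
  twisted_weight M z.
Proof.
move=> z0; rewrite /site_weight /radial_coord /twisted_weight mulNr.
rewrite [RHS]mulrAC mulrA; congr (_ * _).
rewrite -!powR_mulrn ?powR_ge0 ?modulus_ge0// -powRrM -!powRD ?z0 ?implybT//.
congr (_ `^ _); rewrite natrM natrD natrM.
have -> : (k.-1%:R : R) = k%:R - 1 by rewrite -subn1 natrB//; case/andP: hkM.
by field.
Qed.

(** The Gamma density of shape [k + M l] and rate [N], written through a Poisson weight: a sum over
    [l] at fixed [x] then becomes a Poisson probability of a residue class. *)
Definition gamma_density l (x : R) : R :=
  N%:R * poisson_weight (N%:R * x) (k.-1 + M * l).

Lemma gamma_densityE l x : gamma_density l x =
  (pi * M%:R / site_norm l) * (x ^+ (k.-1 + M * l) * expR (- N%:R * x)).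
Proof.
rewrite /gamma_density /poisson_weight /site_norm.
have -> : (k + M * l = (k.-1 + M * l).+1)%N by case/andP: hkM => k1 _; lia.
set j := (k.-1 + M * l)%N.
rewrite mulNr exprMn exprS; move: (pi_gt0 R); move: (pi : R) => p p0; field.
by rewrite !gt_eqF ?exprn_gt0 ?ltr0n ?fact_gt0.
Qed.

Lemma measurable_gamma_density l : measurable_fun setT (gamma_density l).
Proof.
apply: measurable_funM => //; apply: measurable_funM; last first.
  apply: (measurableT_comp (@measurable_expR R)); apply: measurable_funN.
  exact: measurable_funM.
by apply: measurable_funM => //; apply: measurable_funX; exact: measurable_funM.
Qed.

Lemma gamma_density_ge0 l x : 0 <= x -> 0 <= gamma_density l x.
Proof. by move=> x0; rewrite mulr_ge0 ?poisson_weight_ge0// mulr_ge0. Qed.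

Local Open Scope ereal_scope.

(* The l-th one-point marginal, read in the radial coordinate, is a Gamma law. *)
Lemma integral_site_weight l (F : plane R -> \bar R) :
    measurable_fun setT F -> (forall z, 0 <= F z) ->
  \int[m]_z (F z * (modulus z ^+ (2 * l) * site_weight z)%:E) =
  (site_norm l / (pi * M%:R))%:E * \int[m]_z
    (F z * (gamma_density l (radial_coord M z) * twisted_weight M z)%:E).
Proof.
move=> mF F0.
have mrad := @measurable_radial_coord R M.
have mg : measurable_fun setT (fun z => (gamma_density l (radial_coord M z) * twisted_weight M z)%R).
  apply: measurable_funM; last exact: measurable_twisted_weight.
  exact: (measurableT_comp (measurable_gamma_density _) mrad).
have g0 z : (0 <= gamma_density l (radial_coord M z) * twisted_weight M z)%R.
  by rewrite mulr_ge0 ?gamma_density_ge0 ?powR_ge0.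
have sn := site_norm_gt0 l.
rewrite -ge0_integralZl//; last 3 first.
- by apply: emeasurable_funM => //; apply/measurable_EFinP.
- by move=> z _; rewrite mule_ge0// lee_fin.
- by rewrite lee_fin divr_ge0 ?(ltW sn)// mulr_ge0 ?pi_ge0.
apply: ge0_ae_eq_integral => //.
- apply: emeasurable_funM => //; apply/measurable_EFinP; apply: measurable_funM.
    by apply: measurable_funX; exact: measurable_modulus.
  exact: measurable_site_weight.
- apply: emeasurable_funM => //; apply: emeasurable_funM => //; exact/measurable_EFinP.
- by move=> z _; rewrite mule_ge0// lee_fin mulr_ge0 ?site_weight_ge0// exprn_ge0// modulus_ge0.
- by move=> z _; rewrite mule_ge0 ?mule_ge0 ?lee_fin// divr_ge0 ?(ltW sn)// mulr_ge0 ?pi_ge0.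
apply: ae_modulus_neq0 => z z0 _.
rewrite muleCA -EFinM site_weight_radial// gamma_densityE; congr (_ * _%:E).
move: (pi_gt0 R); move: (pi : R) => p p0.
by field; rewrite !gt_eqF ?ltr0n.
Qed.

Lemma integral_gamma_density l :
  \int[m]_z (gamma_density l (radial_coord M z) * twisted_weight M z)%:E =
  (pi * M%:R)%:E.
Proof.
(* [integral_radial] takes functions that are nonnegative on the whole line, whereas [gamma_density]
   is known to be so only on the half-line; hence the absolute value. *)
have mg : measurable_fun setT (fun x => (`|gamma_density l x|)%:E : \bar R).
  apply/measurable_EFinP; apply: measurableT_comp => //.
  exact: measurable_gamma_density.
have g0 (x : R) := @gamma_density_ge0 l x.
transitivity (\int[m]_z ((`|gamma_density l (radial_coord M z)|)%:E * (twisted_weight M z)%:E)).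
  apply: eq_integral => z _; rewrite ger0_norm ?EFinM//.
  by rewrite g0 ?powR_ge0.
rewrite (integral_radial M0 (g := fun x => (`|gamma_density l x|)%:E))//.
transitivity ((pi * M%:R)%:E * \int[@lebesgue_measure R]_(x in `[0%R, +oo[)
  ((pi * M%:R / site_norm l)%:E * (x ^+ (k.-1 + M * l) * expR (- N%:R * x))%:E)).
  congr (_ * _); apply: eq_integral => x; rewrite inE/= in_itv/= andbT => x0.
  by rewrite ger0_norm ?g0// gamma_densityE EFinM.
rewrite ge0_integralZl//; last 3 first.
- apply/measurable_EFinP; apply: measurable_funTS; apply: measurable_funM.
    exact: measurable_funX.
  apply: (measurableT_comp (@measurable_expR R)); exact: measurable_funM.
- by move=> x; rewrite /= in_itv/= andbT => x0; rewrite lee_fin mulr_ge0 ?exprn_ge0 ?expR_ge0.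
- by rewrite lee_fin divr_ge0 ?(ltW (site_norm_gt0 l))// mulr_ge0 ?pi_ge0.
rewrite integral_gamma// -!EFinM; congr EFin; rewrite /site_norm.
have -> : (k + M * l = (k.-1 + M * l).+1)%N by case/andP: hkM => k1 _; lia.
set j := (k.-1 + M * l)%N.
rewrite exprS; move: (pi_gt0 R); move: (pi : R) => p p0.
by field; rewrite !gt_eqF ?exprn_gt0 ?ltr0n ?fact_gt0.
Qed.

End site_weight.

(** * Complex monomials and rotations *)

Section complex_plane.
Variable R : realType.
Local Notation C := R[i].
Local Notation m := (@plane_lebesgue R).

Definition cplx (z : plane R) : C := Complex z.1 z.2.

Lemma normc_ge_abs (z : C) : `|complex.Re z| <= ComplexField.Normc.normc z /\
  `|complex.Im z| <= ComplexField.Normc.normc z.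
Proof.
case: z => a b /=; split; rewrite -sqrtr_sqr ler_wsqrtr//.
  by rewrite lerDl sqr_ge0.
by rewrite lerDr sqr_ge0.
Qed.

Lemma normcX (z : C) n : ComplexField.Normc.normc (z ^+ n) = ComplexField.Normc.normc z ^+ n.
Proof.
elim: n => [|n IH]; first by rewrite !expr0 ComplexField.Normc.normc1.
by rewrite !exprS ComplexField.Normc.normcM IH.
Qed.

Lemma normc_conj (z : C) : ComplexField.Normc.normc (z^*) = ComplexField.Normc.normc z.
Proof. by rewrite conj_complex; case: z => a b /=; rewrite sqrrN. Qed.

Lemma normc_real (r : R) : ComplexField.Normc.normc (r%:C%C) = `|r|.
Proof. by rewrite /= expr0n/= addr0 sqrtr_sqr. Qed.

Lemma mulconj_normc (z : C) : z * z^* = (ComplexField.Normc.normc z ^+ 2)%:C%C.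
Proof.
rewrite conj_complex; case: z => a b /=.
rewrite sqr_sqrtr ?addr_ge0 ?sqr_ge0//; apply/eqP; rewrite eq_complex/=.
by apply/andP; split; apply/eqP; ring.
Qed.

Section cmeasurable.
Context d (T : measurableType d).

Definition cmeasurable (F : T -> C) : Prop :=
  measurable_fun setT (fun x => complex.Re (F x)) /\
  measurable_fun setT (fun x => complex.Im (F x)).

Lemma cmeasurableM F G : cmeasurable F -> cmeasurable G -> cmeasurable (fun x => F x * G x).
Proof.
move=> [F1 F2] [G1 G2]; split.
  rewrite [X in measurable_fun _ X](_ : _ = (fun x => complex.Re (F x) * complex.Re (G x) -
    complex.Im (F x) * complex.Im (G x))); last first.
    by apply/funext => x; case: (F x); case: (G x).
  by apply: measurable_funB; exact: measurable_funM.
rewrite [X in measurable_fun _ X](_ : _ = (fun x => complex.Re (F x) * complex.Im (G x) +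
  complex.Im (F x) * complex.Re (G x))); last first.
  by apply/funext => x; case: (F x); case: (G x).
by apply: measurable_funD; exact: measurable_funM.
Qed.

Lemma cmeasurable_real (f : T -> R) : measurable_fun setT f -> cmeasurable (fun x => (f x)%:C%C).
Proof. by move=> mf; split => //; exact: measurable_cst. Qed.

Lemma cmeasurableX F n : cmeasurable F -> cmeasurable (fun x => F x ^+ n).
Proof.
move=> mF; elim: n => [|n IH].
  by under [X in cmeasurable X]eq_fun do rewrite expr0; exact: cmeasurable_real.
by under [X in cmeasurable X]eq_fun do rewrite exprS; exact: cmeasurableM.
Qed.

Lemma cmeasurable_conj F : cmeasurable F -> cmeasurable (fun x => (F x)^*).
Proof.
move=> [F1 F2]; split.
  by under eq_fun do rewrite conj_complex.
by under eq_fun do rewrite conj_complex/=; exact: measurable_funN.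
Qed.

Lemma cintegrable_dominated (mu : {measure set T -> \bar R}) F (g : T -> R) :
  cmeasurable F -> mu.-integrable setT (EFin \o g) ->
  (forall x, ComplexField.Normc.normc (F x) <= g x) -> cintegrable mu F.
Proof.
move=> [F1 F2] gi Fg; split; (apply: le_integrable gi => //; first exact/measurable_EFinP);
  move=> x _; rewrite /= lee_fin; have [h1 h2] := normc_ge_abs (F x).
  by rewrite (le_trans h1)// (le_trans (Fg x))// ler_norm.
by rewrite (le_trans h2)// (le_trans (Fg x))// ler_norm.
Qed.

End cmeasurable.

Lemma cmeasurable_cplx : cmeasurable cplx.
Proof. by split; [exact: measurable_fst|exact: measurable_snd]. Qed.

Lemma cplx_rot c s z : cplx (plane_rot c s z) = Complex c s * cplx z.
Proof.
case: z => x y; rewrite /plane_rot/=; apply/eqP; rewrite eq_complex/=.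
by apply/andP; split; apply/eqP; ring.
Qed.

Lemma de_moivre (t : R) n : Complex (cos t) (sin t) ^+ n =
  Complex (cos (n%:R * t)) (sin (n%:R * t)).
Proof.
elim: n => [|n IH]; first by rewrite expr0 mul0r cos0 sin0.
rewrite exprS IH -nat1r mulrDl mul1r cosD sinD; apply/eqP; rewrite eq_complex/=.
by apply/andP; split; apply/eqP; ring.
Qed.

Lemma Rintegral_rot c s (f : plane R -> R) : c ^+ 2 + s ^+ 2 = 1 -> 0 < s ->
  m.-integrable setT (EFin \o f) -> m.-integrable setT (EFin \o (fun z => f (plane_rot c s z))) ->
  \int[m]_z f (plane_rot c s z) = \int[m]_z f z.
Proof.
move=> cs s0 fi fri; have mr := measurable_plane_rot c s.
rewrite /Rintegral; congr fine.
have mf : measurable_fun setT (EFin \o f) by case/integrableP : fi.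
have := integral_pushforward mr mf fri measurableT.
rewrite preimage_setT /= => <-.
apply: eq_measure_integral => // A mA _; exact: plane_lebesgue_rot.
Qed.

Lemma cint_rot c s (F : plane R -> C) : c ^+ 2 + s ^+ 2 = 1 -> 0 < s ->
  cintegrable m F -> cintegrable m (fun z => F (plane_rot c s z)) ->
  cint m (fun z => F (plane_rot c s z)) = cint m F.
Proof.
move=> cs s0 [F1 F2] [G1 G2]; rewrite /cint; congr Complex.
  exact: (Rintegral_rot cs s0 (f := fun z => complex.Re (F z))).
exact: (Rintegral_rot cs s0 (f := fun z => complex.Im (F z))).
Qed.

(* Rotating by [pi / (2 * (b - a))] multiplies [z ^ a * conj z ^ b] by [- i]. *)
Lemma monomials_orthogonal (W : plane R -> R) a b : (a < b)%N ->
  (forall c s z, c ^+ 2 + s ^+ 2 = 1 -> W (plane_rot c s z) = W z) ->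
  cintegrable m (fun z => cplx z ^+ a * (cplx z ^+ b)^* * (W z)%:C%C) ->
  cint m (fun z => cplx z ^+ a * (cplx z ^+ b)^* * (W z)%:C%C) = 0.
Proof.
move=> ab WE iF; set F := fun z => _ in iF *.
pose t : R := pi / 2 / (b - a)%:R.
have n0 : 0 < (b - a)%:R :> R by rewrite ltr0n subn_gt0.
have t0 : 0 < t by rewrite divr_gt0 ?divr_gt0 ?pi_gt0.
(* An angle strictly between 0 and pi has a positive sine, as [cint_rot] requires. *)
have tpi : t < pi.
  apply: (@le_lt_trans _ _ (pi / 2)).
    by rewrite ler_pdivrMr// ler_peMr ?divr_ge0 ?pi_ge0// ler1n subn_gt0.
  by rewrite ltr_pdivrMr// ltr_pMr ?pi_gt0// ltr1n.
pose u : C := Complex (cos t) (sin t).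
have cs : cos t ^+ 2 + sin t ^+ 2 = 1 by exact: cos2Dsin2.
have uu : u * u^* = 1.
  by rewrite mulconj_normc /= sqr_sqrtr ?addr_ge0 ?sqr_ge0// cs.
have ud : u ^+ (b - a) = Complex 0 1.
  rewrite de_moivre /t mulrC divfK ?gt_eqF//.
  by rewrite cos_pihalf sin_pihalf.
have FE z : F (plane_rot (cos t) (sin t) z) = Complex 0 (-1) * F z.
  rewrite /F WE// cplx_rot -/u !exprMn rmorphM/=.
  have -> : u ^+ a * cplx z ^+ a * ((u ^+ b)^* * (cplx z ^+ b)^*) * (W z)%:C%C =
    (u ^+ a * (u ^+ b)^*) * (cplx z ^+ a * (cplx z ^+ b)^* * (W z)%:C%C).
    by rewrite -!mulrA; congr (_ * _); rewrite mulrCA.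
  congr (_ * _).
  rewrite -[in u ^+ b](subnKC (ltnW ab)) exprD rmorphM/= mulrA rmorphXn/= -exprMn uu.
  by rewrite expr1n mul1r ud conj_complex/=.
have iG : cintegrable m (fun z => F (plane_rot (cos t) (sin t) z)).
  by under [X in cintegrable _ X]eq_fun do rewrite FE; exact: cintegrableZ.
have st : 0 < sin t by rewrite sin_gt0_pi// t0.
have := cint_rot cs st iF iG.
under [X in cint _ X]eq_fun do rewrite FE.
rewrite cintZ//; move: (cint m F) => x /eqP.
rewrite -subr_eq0 -{2}[x]mul1r -mulrBl mulf_eq0 => /orP[|/eqP//].
by rewrite eq_complex/= sub0r oppr_eq0 oner_eq0.
Qed.

End complex_plane.

Section partition_function.
Variables (R : realType) (N M k : nat).
Hypotheses (hkM : (1 <= k <= M)%N) (N0 : (0 < N)%N).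
Local Notation C := R[i].
Local Notation m := (@plane_lebesgue R).
Local Notation sw := (@site_weight R N M k).
Local Notation n := (gin_card N M k).
Local Notation snorm := (@site_norm R N M k).
Local Notation pm := (power_measure m n).

Lemma integral_site_norm l :
  (\int[m]_z (modulus z ^+ (2 * l) * sw z)%:E = (snorm l)%:E)%E.
Proof.
have := integral_site_weight hkM N0 l (@measurable_cst _ _ _ _ _ (1%E : \bar R))
  (fun=> lee01).
under eq_integral => z _ do rewrite mul1e.
move=> ->; under eq_integral => z _ do rewrite mul1e.
rewrite integral_gamma_density// -EFinM divfK// gt_eqF//.
by rewrite mulr_gt0 ?pi_gt0// ltr0n; case/andP: hkM => k1; exact: leq_trans.
Qed.

Lemma measurable_site_moment l : measurable_fun setT (fun z => modulus z ^+ (2 * l) * sw z).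
Proof.
apply: measurable_funM; last exact: measurable_site_weight.
by apply: measurable_funX; exact: measurable_modulus.
Qed.

Lemma site_moment_ge0 l z : 0 <= modulus z ^+ (2 * l) * sw z.
Proof. by rewrite mulr_ge0 ?site_weight_ge0// exprn_ge0// modulus_ge0. Qed.

Lemma integrable_site_moment l :
  m.-integrable setT (fun z => (modulus z ^+ (2 * l) * sw z)%:E).
Proof.
apply/integrableP; split; first by apply/measurable_EFinP; exact: measurable_site_moment.
under eq_integral => z _ do rewrite gee0_abs ?lee_fin ?site_moment_ge0//.
by rewrite integral_site_norm ltry.
Qed.

Variables (h : plane R -> R) (B : R).
Hypotheses (mh : measurable_fun setT h) (hB : forall z, 0 <= h z <= B).

Let h0 z : 0 <= h z. Proof. by have /andP[] := hB z. Qed.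
Let hle z : h z <= B. Proof. by have /andP[] := hB z. Qed.
Let B0 : 0 <= B. Proof. exact: le_trans (h0 (0, 0)) (hle _). Qed.

Local Notation W := (fun z => sw z * h z).
Local Notation phi := (fun (l : 'I_n) z => cplx z ^+ l).

(** Domination by [|z|^a |z|^b <= |z|^(2 a) + |z|^(2 b)], whose two terms have the finite masses
    [site_norm], and by the bound [B] on [h]. *)
Lemma cintegrable_site a b :
  cintegrable m (fun z => cplx z ^+ a * (cplx z ^+ b)^* * (W z)%:C%C).
Proof.
apply: (@cintegrable_dominated _ _ _ _ _
  (fun z => B * (modulus z ^+ (2 * a) * sw z + modulus z ^+ (2 * b) * sw z))).
- apply: cmeasurableM; last first.
    by apply: cmeasurable_real; apply: measurable_funM => //; exact: measurable_site_weight.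
  apply: cmeasurableM; last apply: cmeasurable_conj; apply: cmeasurableX; exact: cmeasurable_cplx.
- apply: (eq_integrable _ (fun z => B%:E * ((modulus z ^+ (2 * a) * sw z)%:E +
    (modulus z ^+ (2 * b) * sw z)%:E))%E) => //.
  by apply: integrableZl => //; apply: integrableD => //; exact: integrable_site_moment.
move=> z; rewrite !ComplexField.Normc.normcM normc_conj !normcX normc_real.
rewrite -/(modulus z) ger0_norm; last by rewrite mulr_ge0 ?site_weight_ge0.
rewrite -mulrDl !(mulnC 2) !exprM.
set x := modulus z ^+ a; set y := modulus z ^+ b.
have x0 : 0 <= x by rewrite exprn_ge0 ?modulus_ge0.
have y0 : 0 <= y by rewrite exprn_ge0 ?modulus_ge0.
have xy : x * y <= x ^+ 2 + y ^+ 2 by have := sqr_ge0 (x - y); nra.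
have w0 := site_weight_ge0 N M k z.
rewrite [leRHS]mulrC -[leRHS]mulrA; apply: ler_pM => //; [exact: mulr_ge0..|].
exact: ler_wpM2l.
Qed.

Lemma gram_entry_diag l :
  cint m (fun z => cplx z ^+ l * (cplx z ^+ l)^* * (W z)%:C%C) =
  (\int[m]_z (modulus z ^+ (2 * l) * sw z * h z))%:C%C.
Proof.
rewrite -cint_real; congr cint; apply/funext => z.
rewrite mulconj_normc normcX -/(modulus z) -exprM mulnC.
by rewrite -rmorphM/= mulrA.
Qed.

Lemma normc_prod I (r : seq I) (Q : pred I) (F : I -> C) :
  ComplexField.Normc.normc (\prod_(i <- r | Q i) F i) =
  \prod_(i <- r | Q i) ComplexField.Normc.normc (F i).
Proof.
apply: (big_morph (@ComplexField.Normc.normc R)); last exact: ComplexField.Normc.normc1.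
exact: ComplexField.Normc.normcM.
Qed.

(** The monomials evaluated at the points form a transposed Vandermonde matrix, and [z * z^*] is the
    square of the modulus. *)
Lemma det_weight_gin (t : n.-tuple (plane R)) :
  det_weight phi W t = (gin_weight N M k t * \prod_(i < n) h (tnth t i))%:C%C.
Proof.
rewrite /det_weight.
have -> : \matrix_(i, j) phi j (tnth t i) = (Vandermonde n (\row_i cplx (tnth t i)))^T.
  by apply/matrixP => i j; rewrite !mxE.
rewrite det_tr det_Vandermonde mulconj_normc.
rewrite -rmorph_prod/= -rmorphM; congr ((_)%:C%C).
rewrite big_split/= mulrA; congr (_ * _); congr (_ * _).
rewrite normc_prod -prodrXl; apply: eq_bigr => i _.
rewrite normc_prod -prodrXl; apply: eq_bigr => j _; congr (_ ^+ 2).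
rewrite !mxE; case: (tnth t i) => a b; case: (tnth t j) => a' b'.
by rewrite /modulus /= -(opprB a) -(opprB b) !sqrrN.
Qed.

Lemma gin_partition : pm.-integrable setT
    (fun t => (gin_weight N M k t * \prod_(i < n) h (tnth t i))%:E) /\
  (\int[pm]_t (gin_weight N M k t * \prod_(i < n) h (tnth t i)))%:C%C =
    n`!%:R * \det (gram m phi W).
Proof.
have [i1 e1] := @andreief _ _ R m n phi W (fun a b => cintegrable_site a b).
have E : det_weight phi W = (fun t => (gin_weight N M k t * \prod_(i < n) h (tnth t i))%:C%C).
  by apply/funext => t; exact: det_weight_gin.
by rewrite -e1 E cint_real; split => //; apply/cintegrable_real; rewrite -E.
Qed.

Lemma gin_partition_le :
  \int[pm]_t (gin_weight N M k t * \prod_(i < n) h (tnth t i)) <=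
  n`!%:R * \prod_(l < n) \int[m]_z (modulus z ^+ (2 * l) * sw z * h z).
Proof.
have [_ e] := gin_partition.
rewrite -lecR e rmorphM rmorph_nat rmorph_prod ler_wpM2l//.
have iF (a b : 'I_n) := cintegrable_site a b.
have /andP[_] := hadamard (hermitian_gram iF) (psd_gram iF (fun z => mulr_ge0 (site_weight_ge0 N M k z) (h0 z))).
move=> /le_trans; apply; rewrite le_eqVlt; apply/orP; left; apply/eqP.
by apply: eq_bigr => l _; rewrite mxE /gram_entry gram_entry_diag.
Qed.

End partition_function.

Lemma site_weight_rot (R : realType) (N M k : nat) (c s : R) z :
  c ^+ 2 + s ^+ 2 = 1 -> site_weight N M k (plane_rot c s z) = site_weight N M k z.
Proof. by move=> cs; rewrite /site_weight modulus_rot. Qed.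

(** The case [h = 1], where orthogonality of the monomials makes Hadamard's inequality an equality.
    The exact value determines the normalising constant of [is_Gin]. *)
Lemma gin_partition1 (R : realType) (N M k : nat) :
  (1 <= k <= M)%N -> (0 < N)%N ->
  (power_measure (@plane_lebesgue R) (gin_card N M k)).-integrable setT
    (EFin \o gin_weight N M k) /\
  \int[power_measure (@plane_lebesgue R) (gin_card N M k)]_t gin_weight N M k t =
  (gin_card N M k)`!%:R * \prod_(l < gin_card N M k) @site_norm R N M k l.
Proof.
move=> hkM N0; set n := gin_card N M k.
pose h1 : plane R -> R := cst 1.
have h01 z : 0 <= h1 z <= 1 by rewrite /= ler01 lexx.
have mh1 : measurable_fun setT h1 by exact: measurable_cst.
have [i1 e] := gin_partition hkM N0 mh1 h01.
have E t : gin_weight N M k t * \prod_(i < n) h1 (tnth t i) = gin_weight N M k t.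
  by rewrite big1 ?mulr1.
split; first by apply: eq_integrable i1 => // t _; rewrite E.
apply: (@complexI R); rewrite rmorphM rmorph_nat rmorph_prod.
rewrite -(eq_Rintegral _ (fun t _ => E t)) e; congr (_ * _).
set phi := fun (l : 'I_n) z => _; set W := fun z => _.
have iF (a b : 'I_n) := cintegrable_site hkM N0 mh1 h01 a b.
have orth (a b : 'I_n) : (a < b)%N -> gram (@plane_lebesgue R) phi W a b = 0.
  move=> ab; rewrite mxE /gram_entry.
  apply: (@monomials_orthogonal R W a b ab _ (iF a b)) => c s z cs.
  by rewrite /W site_weight_rot.
suff -> : gram (@plane_lebesgue R) phi W = diag_mx (\row_l (@site_norm R N M k l)%:C%C).
  by rewrite det_diag; apply: eq_bigr => l _; rewrite mxE.
apply/matrixP => a b; rewrite [RHS]mxE [X in _ = X *+ _]mxE.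
have [ab|ba|/val_inj ->] := ltngtP a b.
- by rewrite orth// -val_eqE/= ltn_eqF.
- by rewrite (hermitian_gram iF) orth// conjC0 -val_eqE/= gtn_eqF.
rewrite eqxx mxE /gram_entry gram_entry_diag /=; congr ((_)%:C%C).
rewrite /Rintegral -[RHS](congr1 fine (integral_site_norm R hkM N0 b)).
by congr fine; apply: eq_integral => z _; rewrite mulr1.
Qed.

(** * Concentration *)

Section concentration.
Variables (R : realType) (N M k : nat).
Hypotheses (hkM : (1 <= k <= M)%N) (N0 : (0 < N)%N).
Local Notation m := (@plane_lebesgue R).
Local Notation sw := (@site_weight R N M k).
Local Notation n := (gin_card N M k).
Local Notation snorm := (@site_norm R N M k).
Local Notation pm := (power_measure m n).

(** The expectation written E_l in the overview. *)
Definition site_mean (l : nat) (g : plane R -> R) : R :=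
  (\int[m]_z (modulus z ^+ (2 * l) * sw z * g z)) / snorm l.

(** [expR y <= 1 / (1 - y)], and [(1 + y + 2 y^2) (1 - y) = 1 + y^2 (1 - 2 y)] is at least 1 for
    [y <= 1/2]. *)
Lemma expR_le_quadratic (y : R) : `|y| <= 2^-1 -> expR y <= 1 + y + 2 * y ^+ 2.
Proof.
rewrite ler_norml => /andP[y1 y2].
have h : 0 < 1 - y by lra.
apply: (@le_trans _ _ (1 - y)^-1).
  by rewrite -[X in X <= _]invrK -expRN lef_pV2 ?posrE ?expR_gt0// expR_ge1Dx.
by rewrite -[leLHS]mul1r ler_pdivrMr//; nra.
Qed.

Lemma integrable_bounded_site l (g : plane R -> R) (B : R) :
  measurable_fun setT g -> (forall z, `|g z| <= B) ->
  m.-integrable setT (EFin \o (fun z => modulus z ^+ (2 * l) * sw z * g z)).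
Proof. exact: integrable_bounded_mul (integrable_site_moment R hkM N0 l). Qed.

(** Apply [expR_le_quadratic] to [s * g z] pointwise, integrate against the site weight, and return
    to an exponential by [1 + x <= expR x]. *)
Lemma site_exp_le l (g : plane R -> R) (B s : R) :
  measurable_fun setT g -> (forall z, `|g z| <= B) -> 0 <= s -> s * B <= 2^-1 ->
  \int[m]_z (modulus z ^+ (2 * l) * sw z * expR (s * g z)) <=
  snorm l * expR (s * site_mean l g + 2 * (s * B) ^+ 2).
Proof.
move=> mg gB s0 sB.
have B0 : 0 <= B by rewrite (le_trans _ (gB (0, 0))).
have sn := @site_norm_gt0 R _ _ k hkM N0 l.
have sgB z : `|s * g z| <= s * B by rewrite normrM ger0_norm// ler_wpM2l.
have mE : measurable_fun setT (fun z => expR (s * g z)).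
  by apply: measurableT_comp => //; exact: measurable_funM.
have i1 : m.-integrable setT (EFin \o (fun z => modulus z ^+ (2 * l) * sw z * expR (s * g z))).
  apply: (@integrable_bounded_site l _ (expR (s * B))) => // z.
  by rewrite ger0_norm ?expR_ge0// ler_expR (le_trans _ (sgB z))// ler_norm.
have i2 : m.-integrable setT (EFin \o (fun z => modulus z ^+ (2 * l) * sw z)).
  exact: integrable_site_moment.
have i3 := integrable_bounded_site l mg gB.
have H1 : \int[m]_z (modulus z ^+ (2 * l) * sw z * expR (s * g z)) <=
    \int[m]_z (s * (modulus z ^+ (2 * l) * sw z * g z) +
      (1 + 2 * (s * B) ^+ 2) * (modulus z ^+ (2 * l) * sw z)).
  apply: le_Rintegral; [by []|exact: i1|by apply: integrable_EFinD; exact: integrable_EFinZl|move=> z _].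
  have -> : s * (modulus z ^+ (2 * l) * sw z * g z) +
    (1 + 2 * (s * B) ^+ 2) * (modulus z ^+ (2 * l) * sw z) =
    (modulus z ^+ (2 * l) * sw z) * (1 + s * g z + 2 * (s * B) ^+ 2).
    by move: (modulus z ^+ _) (sw z) => u v; ring.
  rewrite ler_wpM2l ?site_moment_ge0//.
  apply: le_trans (expR_le_quadratic (le_trans (sgB z) sB)) _.
  rewrite lerD2l ler_wpM2l// -real_normK ?num_real// lerXn2r ?nnegrE//.
  by rewrite mulr_ge0.
apply: le_trans H1 _.
rewrite RintegralD//; [|exact: integrable_EFinZl|exact: integrable_EFinZl].
rewrite !RintegralZl//.
have -> : \int[m]_z (modulus z ^+ (2 * l) * sw z) = snorm l.
  by rewrite /Rintegral integral_site_norm.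
have -> : \int[m]_z (modulus z ^+ (2 * l) * sw z * g z) = snorm l * site_mean l g.
  by rewrite /site_mean mulrC divfK// gt_eqF.
apply: (@le_trans _ _ (snorm l * (1 + (s * site_mean l g + 2 * (s * B) ^+ 2)))).
  by rewrite le_eqVlt; apply/orP; left; apply/eqP; ring.
by rewrite ler_wpM2l ?(ltW sn)// expR_ge1Dx.
Qed.

Lemma measurable_gin_sum (g : plane R -> R) : measurable_fun setT g ->
  measurable_fun setT (fun t : n.-tuple (plane R) => \sum_(i < n) g (tnth t i)).
Proof.
move=> mg; apply: measurable_sum => i.
by apply: (measurableT_comp mg); exact: measurable_tnth.
Qed.

Lemma gin_weight_ge0 (t : n.-tuple (plane R)) : 0 <= gin_weight N M k t.
Proof.
rewrite mulr_ge0// prodr_ge0// => i _.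
  by rewrite prodr_ge0// => j _; rewrite exprn_ge0// modulus_ge0.
exact: (site_weight_ge0 N M k).
Qed.

(** The exponential Markov inequality. The exponential moment is the quotient of the partition
    function for [h = expR (s g)], bounded by Hadamard, by the exact one for [h = 1]. *)
Lemma gin_chernoff (Q : set (n.-tuple (plane R)) -> \bar R) (g : plane R -> R) (B s u : R) :
    is_Gin N M k Q -> Q setT = 1%E ->
    measurable_fun setT g -> (forall z, `|g z| <= B) -> 0 <= s -> s * B <= 2^-1 ->
  (Q [set t | (u <= \sum_(i < n) g (tnth t i))%R] <=
   (expR (- (s * u) + s * (\sum_(l < n) site_mean l g) + n%:R * (2 * (s * B) ^+ 2)))%:E)%E.
Proof.
move=> [a a0 QE] Q1 mg gB s0 sB.
have [iw wE] := @gin_partition1 R N M k hkM N0.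
(* Total mass 1 forces [a] to be the inverse of the exact partition function. *)
have aw : a * (n`!%:R * \prod_(l < n) snorm l) = 1.
  have := Q1; rewrite QE// -wE => h; apply: EFin_inj; rewrite -h.
  rewrite -RintegralZl// /Rintegral fineK//; apply: integrable_fin_num => //.
  exact: integrable_EFinZl.
pose h z := expR (s * g z).
have mh : measurable_fun setT h by apply: measurableT_comp => //; exact: measurable_funM.
have hB z : 0 <= h z <= expR (s * B).
  by rewrite expR_ge0 ler_expR ler_wpM2l// (le_trans _ (gB z))// ler_norm.
have [ih _] := gin_partition hkM N0 mh hB.
have hle := gin_partition_le hkM N0 mh hB.
have mw : measurable_fun setT (@gin_weight R N M k).
  by apply/measurable_EFinP; case/integrableP : iw.
set A := [set t | _].
have mA : measurable A.
  rewrite -[A]setTI.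
  by apply: (@measurable_fun_ler _ _ _ setT (cst u) _ _ (measurable_gin_sum mg) measurableT [set true]).
rewrite QE//.
(* The density multiplied by [expR (s (sum_i g - u))], a factor that is at least 1 on [A]. *)
pose F t := expR (- (s * u)) * a * (gin_weight N M k t * \prod_(i < n) h (tnth t i)).
have iF : pm.-integrable setT (EFin \o F).
  exact: integrable_EFinZl.
have F0 t : 0 <= F t.
  apply: mulr_ge0; first by rewrite mulr_ge0 ?expR_ge0 ?(ltW a0).
  apply: mulr_ge0; first exact: gin_weight_ge0.
  by apply: prodr_ge0 => i _; exact: expR_ge0.
have mF : measurable_fun setT F by apply/measurable_EFinP; case/integrableP : iF.
apply: (@le_trans _ _ (\int[pm]_t (F t)%:E)%E).
  apply: (@le_trans _ _ (\int[pm]_(t in A) (F t)%:E)%E).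
    apply: ge0_le_integral => //.
    - by move=> t _; rewrite lee_fin; apply: mulr_ge0; [exact: ltW|exact: gin_weight_ge0].
    - by apply/measurable_EFinP; apply: measurable_funTS; exact: measurable_funM.
    - by apply/measurable_EFinP; exact: measurable_funTS.
    move=> t /= At; rewrite lee_fin.
    have -> : F t = a * gin_weight N M k t * expR (s * (\sum_(i < n) g (tnth t i) - u)).
      rewrite /F /h -expR_sum -mulr_sumr mulrBr expRD [RHS]mulrC.
      by move: (expR _) (expR _) (gin_weight _ _ _ _) => e1 e2 w; ring.
    rewrite ler_peMr//; first by apply: mulr_ge0; [exact: ltW|exact: gin_weight_ge0].
    rewrite -expR0 ler_expR.
    by rewrite mulr_ge0// subr_ge0.
  apply: ge0_subset_integral => //; first by apply/measurable_EFinP.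
  by move=> t _; rewrite lee_fin.
have -> : (\int[pm]_t (F t)%:E = (\int[pm]_t F t)%:E)%E.
  by rewrite /Rintegral fineK//; exact: integrable_fin_num.
rewrite lee_fin RintegralZl//.
have sn l : 0 < snorm l by exact: site_norm_gt0.
apply: (@le_trans _ _ (expR (- (s * u)) * a * (n`!%:R * \prod_(l < n)
    (snorm l * expR (s * site_mean l g + 2 * (s * B) ^+ 2))))).
  rewrite ler_wpM2l ?mulr_ge0 ?expR_ge0 ?(ltW a0)//.
  apply: (le_trans hle); rewrite ler_wpM2l//.
  apply: ler_prod => l _; rewrite (site_exp_le l mg gB s0 sB) andbT.
  apply: Rintegral_ge0 => z _; rewrite mulr_ge0 ?site_moment_ge0//.
  exact: expR_ge0.
have es : \sum_(l < n) (s * site_mean l g + 2 * (s * B) ^+ 2) =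
    s * (\sum_(l < n) site_mean l g) + n%:R * (2 * (s * B) ^+ 2).
  by rewrite big_split/= -mulr_sumr sumr_const card_ord -[X in _ + X = _]mulr_natl.
rewrite big_split/= -expR_sum es -addrA [X in _ <= X]expRD.
rewrite -[X in X <= _]mulrA ler_wpM2l ?expR_ge0// !mulrA -[a * _ * _]mulrA aw mul1r.
exact: lexx.
Qed.

End concentration.

(** * The mean empirical measure *)

Section upper_tail.
Variables (R : realType) (M k : nat).
Hypothesis hkM : (1 <= k <= M)%N.

Lemma gin_upper_tail (g : plane R -> R) (B eps : R) : 0 < B -> 0 < eps ->
    measurable_fun setT g -> (forall z, `|g z| <= B) ->
  exists2 delta : R, 0 < delta & forall N Q, (0 < N)%N ->
    @is_Gin R N M k Q -> Q setT = 1%E ->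
    (Q [set t | ((\sum_(l < gin_card N M k) site_mean N M k l g) + eps * (gin_card N M k)%:R <=
                \sum_(i < gin_card N M k) g (tnth t i))%R] <=
     (expR (- (delta * (gin_card N M k)%:R)))%:E)%E.
Proof.
move=> B0 eps0 mg gB.
(* The second entry ensures [s * B <= 1/2]; the first makes the quadratic error [2 (s B)^2] at most
   half of the gain [s * eps]. The other half is [delta], which depends on neither [N] nor [Q]. *)
pose s := Num.min (eps / (4 * B ^+ 2)) (2 * B)^-1.
have s0 : 0 < s.
  by rewrite lt_min divr_gt0 ?invr_gt0 ?mulr_gt0 ?exprn_gt0.
have sB : s * B <= 2^-1.
  apply: (@le_trans _ _ ((2 * B)^-1 * B)).
    by rewrite ler_wpM2r ?(ltW B0)// ge_min lexx orbT.
  by rewrite invfM mulfVK// gt_eqF.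
have se : 2 * (s * B) ^+ 2 <= s * eps / 2.
  have : s * (4 * B ^+ 2) <= eps.
    by rewrite -ler_pdivlMr ?mulr_gt0 ?exprn_gt0// ge_min lexx.
  by move: s0 => {}s0 h; rewrite exprMn; nra.
exists (s * eps / 2) => [|N Q N0 QG Q1]; first by rewrite divr_gt0 ?mulr_gt0.
set n := gin_card N M k; set mu := \sum_(l < n) _.
have h := @gin_chernoff R N M k hkM N0 Q g B s (mu + eps * n%:R) QG Q1 mg gB (ltW s0) sB.
apply: le_trans h _; rewrite lee_fin ler_expR -/n -/mu.
have := ler_wpM2l (ler0n R n) se; set x := 2 * _; set y := n%:R => h.
by move: h; rewrite mulrDr; lra.
Qed.

End upper_tail.

(** * The averaged one-point density and its limit *)

Section mixture_density.
Variables (R : realType) (M k : nat).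
Hypothesis hkM : (1 <= k <= M)%N.
Local Notation m := (@plane_lebesgue R).
Local Notation X := (@radial_coord R M).
Local Notation w := (@twisted_weight R M).
Local Notation D := (@unit_disk R).

Let w0 z : 0 <= w z. Proof. exact: powR_ge0. Qed.
Let mw : measurable_fun setT w. Proof. exact: measurable_twisted_weight. Qed.

Let M0 : (0 < M)%N. Proof. by case/andP: hkM => k1; exact: leq_trans. Qed.

Let piM0 : 0 < pi * M%:R :> R. Proof. by rewrite mulr_gt0 ?pi_gt0 ?ltr0n. Qed.

(** The function q_N of the overview: [N] times a Poisson probability, divided by [c]. *)
Definition mixture_density N (x : R) : R :=
  (gin_card N M k)%:R^-1 * \sum_(l < gin_card N M k) gamma_density N M k l x.

Lemma mixture_density_ge0 N x : 0 <= x -> 0 <= mixture_density N x.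
Proof.
move=> x0; rewrite mulr_ge0 ?invr_ge0// sumr_ge0// => l _.
exact: gamma_density_ge0.
Qed.

Lemma measurable_mixture_density N : measurable_fun setT (mixture_density N).
Proof.
apply: measurable_funM => //; apply: measurable_sum => l.
exact: measurable_gamma_density.
Qed.

Lemma unit_diskE z : D z <-> X z < 1.
Proof.
rewrite /unit_disk/= -(@expr_lt1 _ 2)// ?modulus_ge0// -(radial_coord_powM M0).
by rewrite expr_lt1// powR_ge0.
Qed.

Lemma measurable_unit_disk : measurable D.
Proof.
rewrite -[D]setTI.
by apply: (@measurable_fun_ltr _ _ _ setT (@modulus R) (cst 1) _ _ measurableT [set true]) => //;
  exact: measurable_modulus.
Qed.

(** This is the normalisation of the twisted circular law. The mass agrees with that of the weight
    times the mixture density, as Scheffe's argument requires. *)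
Lemma integral_disk_weight :
  (\int[m]_(z in D) (w z)%:E = (pi * M%:R)%:E)%E.
Proof.
pose A : set R := [set x | x < 1].
have mA : measurable A.
  have -> : A = `]-oo, 1[%classic by apply/seteqP; split => x; rewrite /A/= in_itv.
  exact: measurable_itv.
have mind : measurable_fun setT (fun x : R => (\1_A x)%:E : \bar R).
  by apply/measurable_EFinP; exact: measurable_indic.
have i0 (x : R) : (0 <= (\1_A x)%:E :> \bar R)%E by rewrite lee_fin.
have := integral_radial M0 mind i0; rewrite integral_indic//.
move=> h; rewrite integral_mkcond.
transitivity (\int[m]_z ((\1_A (X z))%:E * (w z)%:E))%E.
  apply: eq_integral => z _; rewrite patchE indicE.
  have [zD|zD] := boolP (z \in D).
    by rewrite mem_set ?mul1e//; apply/unit_diskE; exact/set_mem.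
  rewrite memNset ?mul0e// => /unit_diskE h'; move: zD; rewrite mem_set//.
rewrite h.
have AE : A `&` `[0, +oo[ = `[0, 1[%classic.
  by apply/seteqP; split => x; rewrite /A/= !in_itv/= andbT; [case=> -> ->|move=> /andP[-> ->]].
have lE : lebesgue_measure (A `&` `[0, +oo[) = 1%E.
  by rewrite AE lebesgue_measure_itv/= lte_fin ltr01 oppr0 adde0.
transitivity ((pi * M%:R)%:E * 1 : \bar R)%E; last by rewrite mule1.
by congr (_ * _)%E; exact: lE.
Qed.

Lemma integrable_disk_weight : m.-integrable setT (EFin \o (fun z => \1_D z * w z)).
Proof.
apply/integrableP; split.
  apply/measurable_EFinP; apply: measurable_funM => //.
  by apply: measurable_indic; exact: measurable_unit_disk.
rewrite (_ : \int[m]_x _ = (pi * M%:R)%:E)%E ?ltry//.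
rewrite -(integral_disk_weight) [RHS]integral_mkcond; apply: eq_integral => z _.
rewrite /= ger0_norm ?mulr_ge0// patchE indicE.
by case: (z \in D); rewrite ?mul1r ?mul0r.
Qed.

Lemma Rintegral_disk_weight : \int[m]_z (\1_D z * w z) = pi * M%:R.
Proof.
rewrite /Rintegral -[RHS](congr1 fine (integral_disk_weight)); congr fine.
rewrite [RHS]integral_mkcond; apply: eq_integral => z _.
by rewrite patchE indicE; case: (z \in D); rewrite ?mul1r ?mul0r.
Qed.

End mixture_density.

Section mixture_limit.
Variables (R : realType) (M k : nat).
Hypothesis hkM : (1 <= k <= M)%N.
Local Notation m := (@plane_lebesgue R).
Local Notation X := (@radial_coord R M).
Local Notation w := (@twisted_weight R M).
Local Notation D := (@unit_disk R).
Local Notation q := (@mixture_density R M k).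

Let M0 : (0 < M)%N. Proof. by case/andP: hkM => k1; exact: leq_trans. Qed.
Let piM0 : 0 < pi * M%:R :> R. Proof. by rewrite mulr_gt0 ?pi_gt0 ?ltr0n. Qed.
Let w0 z : 0 <= w z. Proof. exact: powR_ge0. Qed.
Let X0 z : 0 <= X z. Proof. exact: powR_ge0. Qed.
Let mw : measurable_fun setT w. Proof. exact: measurable_twisted_weight. Qed.
Let mX : measurable_fun setT X. Proof. exact: measurable_radial_coord. Qed.

Lemma integrable_gamma_weight N l : (0 < N)%N ->
  m.-integrable setT (fun z => (gamma_density N M k l (X z) * w z)%:E).
Proof.
move=> N0; apply/integrableP; split.
  apply/measurable_EFinP; apply: measurable_funM => //.
  exact: (measurableT_comp (measurable_gamma_density _ _ _ _) mX).
under eq_integral => z _.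
  rewrite gee0_abs; last first.
    by rewrite lee_fin mulr_ge0// gamma_density_ge0.
  over.
by rewrite integral_gamma_density// ltry.
Qed.

Lemma site_meanE N l (f : plane R -> R) (B : R) : (0 < N)%N ->
    measurable_fun setT f -> (forall z, `|f z| <= B) ->
  site_mean N M k l f =
  (pi * M%:R)^-1 * \int[m]_z (gamma_density N M k l (X z) * w z * f z).
Proof.
move=> N0 mf fB; rewrite /site_mean.
have sn := @site_norm_gt0 R _ _ k hkM N0 l.
have ig := integrable_bounded_mul (integrable_gamma_weight l N0) mf fB.
have -> : \int[m]_z (modulus z ^+ (2 * l) * site_weight N M k z * f z) =
   \int[m]_z ((site_norm R N M k l / (pi * M%:R)) * (gamma_density N M k l (X z) * w z * f z)).
  rewrite /Rintegral; congr fine; apply: ae_eq_integral => //.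
  - apply/measurable_EFinP; apply: measurable_funM => //.
    exact: measurable_site_moment.
  - by apply/measurable_EFinP; apply: measurable_funM => //; apply/measurable_EFinP; case/integrableP : ig.
  apply: ae_modulus_neq0 => z z0 _; congr EFin.
  rewrite site_weight_radial// gamma_densityE//.
  move: (f z) (w z) (X z ^+ _ * _) => a b c.
  move: piM0 => p0; move: (pi * M%:R) p0 => p p0.
  by field; rewrite !gt_eqF.
rewrite RintegralZl//; move: (\int[m]_z _) => I.
move: piM0 => p0; move: (pi * M%:R) p0 => p p0.
by field; rewrite !gt_eqF.
Qed.

Lemma gin_card_gt0 N : (M <= N)%N -> (0 < gin_card N M k)%N.
Proof. by move=> MN; rewrite gin_cardE// divn_gt0//; case/andP: hkM; lia. Qed.

Lemma integral_mixture_weight N : (M <= N)%N ->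
  m.-integrable setT (fun z => (q N (X z) * w z)%:E) /\
  \int[m]_z (q N (X z) * w z) = pi * M%:R.
Proof.
move=> MN; have N0 : (0 < N)%N by exact: leq_trans M0 MN.
have n0 := gin_card_gt0 MN.
have E z : q N (X z) * w z = (gin_card N M k)%:R^-1 *
    \sum_(l < gin_card N M k) gamma_density N M k l (X z) * w z.
  by rewrite /mixture_density -mulrA mulr_suml.
have iS : m.-integrable setT (EFin \o (fun z => \sum_(l < gin_card N M k) gamma_density N M k l (X z) * w z)).
  have := @integrable_sum _ _ _ m setT measurableT _ (index_enum 'I_(gin_card N M k)) xpredT
    (fun l z => (gamma_density N M k l (X z) * w z)%:E) (fun l _ => integrable_gamma_weight l N0).
  by apply: eq_integrable => // z _; rewrite /= sumEFin.
split.
  have := integrableZl measurableT (gin_card N M k)%:R^-1 iS.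
  by apply: eq_integrable => // z _; rewrite E EFinM.
under eq_Rintegral do rewrite E.
rewrite RintegralZl//.
have -> : \int[m]_z (\sum_(l < gin_card N M k) gamma_density N M k l (X z) * w z) =
    (gin_card N M k)%:R * (pi * M%:R).
  rewrite /Rintegral.
  under eq_integral do rewrite -sumEFin.
  rewrite integral_sum//; last by move=> l; exact: integrable_gamma_weight.
  under eq_bigr do rewrite integral_gamma_density//.
  by rewrite sumEFin /= sumr_const card_ord mulr_natl.
by rewrite mulKf// pnatr_eq0 -lt0n.
Qed.

(** Dominated convergence applies because the positive part never exceeds the indicator of the disk,
    the mixture density being nonnegative. *)
Lemma mixture_defect_cvg0 :
  (\int[m]_z (Num.max 0 (\1_D z - q N (X z)) * w z)%:E)%E @[N --> \oo] --> 0%E.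
Proof.
pose d N z : \bar R := (Num.max 0 (\1_D z - q N (X z)) * w z)%:E.
pose g := EFin \o (fun z : plane R => \1_D z * w z).
have mD1 : measurable_fun setT (\1_D : plane R -> R).
  by apply: measurable_indic; exact: measurable_unit_disk.
have mqX N : measurable_fun setT (fun z => q N (X z)).
  exact: (measurableT_comp (measurable_mixture_density _ _ _) mX).
have md N : measurable_fun setT (d N).
  apply/measurable_EFinP; apply: measurable_funM => //.
  by apply: measurable_maxr => //; exact: measurable_funB.
have ig := integrable_disk_weight R hkM.
have dg : {ae m, forall z N, setT z -> (`|d N z| <= g z)%E}.
  apply: aeW => z N _; rewrite lee_fin ger0_norm; last by rewrite mulr_ge0// le_max lexx.
  rewrite ler_wpM2r// ge_max; apply/andP; split; first by rewrite indicE ler0n.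
  by rewrite lerBlDr lerDl mixture_density_ge0.
have d0 : {ae m, forall z, setT z -> d ^~ z @ \oo --> (0%E : \bar R)}.
  (* At the origin the Poisson mean stays 0 and [cvg_poisson_class] does not apply. *)
  apply: ae_modulus_neq0 => z z0 _.
  have X1 : 0 < X z by rewrite powR_gt0// lt_neqAle modulus_ge0 eq_sym z0.
  suff h : Num.max 0 (\1_D z - q N (X z)) @[N --> \oo] --> (0 : R).
    have h2 : Num.max 0 (\1_D z - q N (X z)) * w z @[N --> \oo] --> (0 * w z : R).
      exact: cvgMr_tmp.
    rewrite mul0r in h2.
    by apply/fine_cvgP; split; [exact: nearW|exact: h2].
  (* Outside the disk the positive part vanishes identically. *)
  have [zD|zD] := boolP (z \in D); last first.
    rewrite indicE (negbTE zD) /=.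
    rewrite [X in X @ _](_ : _ = cst 0); first exact: cvg_cst.
    apply/funext => N; apply/max_idPl; rewrite sub0r oppr_le0.
    exact: mixture_density_ge0.
  have X1' : X z < 1 by apply/(unit_diskE hkM); exact/set_mem.
  have qX : q N (X z) @[N --> \oo] --> (1 : R).
    have := @cvg_poisson_class R M k (X z) hkM; rewrite X1 X1' => /(_ isT).
    rewrite [X in X @ _ --> _ -> _](_ : _ = fun N => q N (X z))//.
    by apply/funext => N; rewrite /mixture_density /gamma_density -mulr_sumr mulrA [_^-1 * _]mulrC.
  rewrite indicE zD.
  apply: (@cvg_dist_squeeze _ _ (fun N => `|1 - q N (X z)|)).
    apply: nearW => N; rewrite subr0 ger0_norm ?le_max ?lexx//.
    by rewrite ge_max normr_ge0 ler_norm.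
  rewrite -(normr0 R) -(subrr (1 : R)); apply: cvg_norm.
  by apply: cvgB => //; exact: cvg_cst.
have [_ _] := dominated_convergence measurableT md (measurable_cst 0%E) d0 ig dg.
by rewrite integral0.
Qed.

End mixture_limit.

Section mean_limit.
Variables (R : realType) (M k : nat).
Hypothesis hkM : (1 <= k <= M)%N.
Local Notation m := (@plane_lebesgue R).
Local Notation X := (@radial_coord R M).
Local Notation w := (@twisted_weight R M).
Local Notation D := (@unit_disk R).
Local Notation q := (@mixture_density R M k).

Let M0 : (0 < M)%N. Proof. by case/andP: hkM => k1; exact: leq_trans. Qed.
Let piM0 : 0 < pi * M%:R :> R. Proof. by rewrite mulr_gt0 ?pi_gt0 ?ltr0n. Qed.
Let w0 z : 0 <= w z. Proof. exact: powR_ge0. Qed.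
Let X0 z : 0 <= X z. Proof. exact: powR_ge0. Qed.
Let mw : measurable_fun setT w. Proof. exact: measurable_twisted_weight. Qed.
Let mX : measurable_fun setT X. Proof. exact: measurable_radial_coord. Qed.

Variables (f : plane R -> R) (B : R).
Hypotheses (mf : measurable_fun setT f) (fB : forall z, `|f z| <= B).

Let B0 : 0 <= B. Proof. by rewrite (le_trans _ (fB (0, 0))). Qed.

Let defect N : R := \int[m]_z (Num.max 0 (\1_D z - q N (X z)) * w z).

Lemma sum_site_mean N : (M <= N)%N ->
  (gin_card N M k)%:R^-1 * \sum_(l < gin_card N M k) site_mean N M k l f =
  (pi * M%:R)^-1 * \int[m]_z (q N (X z) * w z * f z).
Proof.
move=> MN; have N0 : (0 < N)%N by exact: leq_trans M0 MN.
set n := gin_card N M k.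
under eq_bigr => l _ do rewrite (site_meanE hkM l N0 mf fB).
rewrite -mulr_sumr mulrCA; congr (_ * _).
have iS l := integrable_bounded_mul (integrable_gamma_weight R hkM l N0) mf fB.
have -> : \sum_(l < n) \int[m]_z (gamma_density N M k l (X z) * w z * f z) =
   \int[m]_z \sum_(l < n) (gamma_density N M k l (X z) * w z * f z).
  rewrite [RHS]/Rintegral; under eq_integral do rewrite -sumEFin.
  rewrite integral_sum//; last by move=> l; exact: iS.
  rewrite (eq_bigr (fun l : 'I_n => (\int[m]_z (gamma_density N M k l (X z) * w z * f z))%:E)).
    by rewrite sumEFin.
  move=> l _; rewrite /Rintegral fineK//.
  by apply: integrable_fin_num => //; exact: iS.
rewrite -RintegralZl//.
  apply: eq_Rintegral => z _; rewrite /mixture_density -/n -!mulrA; congr (_ * _).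
  by rewrite mulr_suml; apply: eq_bigr => l _; rewrite mulrA.
have := @integrable_sum _ _ _ m setT measurableT _ (index_enum 'I_n) xpredT
    (fun l z => (gamma_density N M k l (X z) * w z * f z)%:E) (fun l _ => iS l).
by apply: eq_integrable => // z _; rewrite /= sumEFin.
Qed.

Lemma mean_distance_le N : (M <= N)%N ->
  `|\int[m]_z (q N (X z) * w z * f z) - \int[m]_z (\1_D z * w z * f z)| <=
  B * (2 * defect N).
Proof.
move=> MN; have [iq Iq] := @integral_mixture_weight R M k hkM N MN.
have iD := integrable_disk_weight R hkM.
have iqf := integrable_bounded_mul iq mf fB.
have iDf := integrable_bounded_mul iD mf fB.
rewrite -RintegralB//.
have idf := integrable_EFinB iqf iDf.
apply: le_trans (le_normr_Rintegral measurableT idf) _.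
pose e z : R := Num.max 0 (\1_D z - q N (X z)) * w z.
have ie : m.-integrable setT (EFin \o e).
  apply: le_integrable iD => //.
    apply/measurable_EFinP; apply: measurable_funM => //; apply: measurable_maxr => //.
    apply: measurable_funB; first by apply: measurable_indic; exact: measurable_unit_disk.
    exact: (measurableT_comp (measurable_mixture_density _ _ _) mX).
  move=> z _; rewrite /= lee_fin /e !ger0_norm ?mulr_ge0 ?le_max ?lexx//.
  rewrite ler_wpM2r// ge_max; apply/andP; split; first by rewrite indicE ler0n.
  by rewrite lerBlDr lerDl mixture_density_ge0.
(* [|a - b| = (a - b) + 2 max(0, b - a)] with [a] the mixture density and [b] the indicator. The
   difference integrates to 0 by equality of masses, leaving twice the defect. *)
pose v z : R := B * ((q N (X z) * w z - \1_D z * w z) + 2 * e z).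
have iv : m.-integrable setT (EFin \o v).
  apply: integrable_EFinZl.
  exact: integrable_EFinD (integrable_EFinB iq iD) (integrable_EFinZl 2 ie).
apply: (@le_trans _ _ (\int[m]_z v z)).
  apply: le_Rintegral => //.
    by have := integrable_norm idf; apply: eq_integrable.
  move=> z _; rewrite -mulrBl normrM /v mulrC; apply: ler_pM => //.
  rewrite /e -mulrBl normrM (ger0_norm (w0 z)) mulrA -mulrDl ler_wpM2r//.
  move: (\1_D z) (q N (X z)) => a b.
  by rewrite /Num.max; case: ltP => h; rewrite ler_norml; apply/andP; split; lra.
rewrite /v RintegralZl//; last first.
  exact: integrable_EFinD (integrable_EFinB iq iD) (integrable_EFinZl 2 ie).
rewrite ler_wpM2l// RintegralD//; [|exact: integrable_EFinB|exact: integrable_EFinZl].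
rewrite RintegralB// Iq (Rintegral_disk_weight R hkM) subrr add0r RintegralZl//.
Qed.

Lemma cvg_mean_site :
  ((gin_card N M k)%:R^-1 * \sum_(l < gin_card N M k) site_mean N M k l f) @[N --> \oo] -->
  ((pi * M%:R)^-1 * \int[m]_(z in D) (f z * w z) : R).
Proof.
have -> : \int[m]_(z in D) (f z * w z) = \int[m]_z (\1_D z * w z * f z).
  rewrite Rintegral_mkcond; apply: eq_Rintegral => z _.
  by rewrite patchE indicE; case: (z \in D); rewrite ?mul1r ?mul0r// mulrC.
apply: (@cvg_dist_squeeze _ _ (fun N => (pi * M%:R)^-1 * (B * (2 * defect N)))).
  exists M => // N /= MN; rewrite sum_site_mean// -mulrBr normrM.
  rewrite ger0_norm ?invr_ge0 ?(ltW piM0)// ler_wpM2l ?invr_ge0 ?(ltW piM0)//.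
  exact: mean_distance_le.
rewrite -(mulr0 (pi * M%:R)^-1); apply: cvgMl_tmp.
rewrite -(mulr0 B); apply: cvgMl_tmp.
rewrite -(mulr0 2); apply: cvgMl_tmp.
have := @mixture_defect_cvg0 R M k hkM => /fine_cvgP[_]; exact.
Qed.

End mean_limit.

(** * Almost sure convergence *)

Section plane_borel.
Variable R : realType.

(** An open set is the union of the rational boxes that it contains. This links the product
    topology, in which [f] is continuous, with the product sigma-algebra. *)
Lemma open_measurable_plane (U : set (R * R)) : open U -> measurable (U : set (plane R)).
Proof.
move=> oU.
pose box (p q r : rat) : set (plane R) :=
  `](ratr p - ratr r)%R, (ratr p + ratr r)%R[ `*` `](ratr q - ratr r)%R, (ratr q + ratr r)%R[.
(* Boxes not contained in [U] are replaced by the empty set, so that the union runs over all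
   rational triples. *)
pose F p q r : set (plane R) := if `[< box p q r `<=` U >] then box p q r else set0.
have -> : (U : set (plane R)) = \bigcup_p \bigcup_q \bigcup_r F p q r.
  apply/seteqP; split => [[x y] Uxy|z [p _ [q _ [r _]]]]; last first.
    by rewrite /F; case: asboolP => // h /h.
  have /nbhs_ballP[e /= e0 eU] : nbhs (x, y) U by exact: open_nbhs_nbhs.
  have [r /andP[r0 re]] : exists r : rat, 0 < (ratr r : R) < e / 2.
    have [r] := rat_in_itvoo (divr_gt0 e0 (ltr0n R 2 : 0 < 2)).
    by rewrite in_itv/= => h; exists r.
  have rat_near (t : R) : exists p : rat, `|t - ratr p| < ratr r.
    have /rat_in_itvoo[p] : t - ratr r < t + ratr r by lra.
    rewrite in_itv/= => /andP[h1 h2]; exists p.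
    by rewrite ltr_norml; apply/andP; split; lra.
  have [p px] := rat_near x; have [q qy] := rat_near y.
  have boxE u v : box p q r (u, v) <-> `|u - ratr p| < ratr r /\ `|v - ratr q| < ratr r.
    rewrite /box /= !in_itv/= !ltr_norml; split => -[/andP[h1 h2] /andP[h3 h4]];
      by split; apply/andP; split; lra.
  exists p => //; exists q => //; exists r => //.
  rewrite /F; case: asboolP => [_|h]; first by apply/boxE.
  exfalso; apply: h => -[u v] /boxE[hu hv]; apply: eU; split => /=.
    rewrite /ball/= (_ : x - u = (x - ratr p) - (u - ratr p)); last by ring.
    by rewrite (le_lt_trans (ler_normB _ _))//; lra.
  rewrite /ball/= (_ : y - v = (y - ratr q) - (v - ratr q)); last by ring.
  by rewrite (le_lt_trans (ler_normB _ _))//; lra.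
do 3 (apply: bigcupT_measurable_rat => ?).
rewrite /F; case: asboolP => // _.
by apply: measurableX; exact: measurable_itv.
Qed.

Lemma continuous_measurable_plane (f : R * R -> R) :
  continuous f -> measurable_fun setT (f : plane R -> R).
Proof.
move=> cf; apply: (measurability _ (RGenOInfty.measurableE R)) => //.
move=> /= _ [_ [a ->] <-]; rewrite setTI.
apply: open_measurable_plane; apply: open_comp; last exact: interval_open.
by move=> z _; exact: cf.
Qed.

End plane_borel.

Section borel_cantelli_exp.
Context d (T : measurableType d) (R : realType) (P : probability T R).
Local Open Scope ereal_scope.

Lemma borel_cantelli_geometric (E : (set T)^nat) (a r : R) :
    (forall N, measurable (E N)) -> (0 <= a)%R -> (0 < r < 1)%R ->
    (forall N, P (E N) <= (a * r ^+ N)%:E) ->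
  {ae P, forall x, \forall N \near \oo, ~ E N x}.
Proof.
move=> mE a0 /andP[r0 r1] PE.
exists (lim_sup_set E); split.
- apply: bigcap_measurable => // n _; exact: bigcup_measurable.
- apply: lim_sup_set_cvg0 => //.
  apply: (@le_lt_trans _ _ (a * (1 - r)^-1)%:E); last exact: ltry.
  apply: lime_le; first by apply: is_cvg_nneseries.
  apply: nearW => n.
  apply: (@le_trans _ _ (\sum_(0 <= i < n) (a * r ^+ i)%:E)); first by apply: lee_sum => i _; exact: PE.
  rewrite sumEFin lee_fin.
  have cv : series (geometric a r) @ \oo --> (a * (1 - r)^-1)%R.
    by apply: cvg_geometric_series; rewrite ger0_norm// ltW.
  rewrite -(cvg_lim _ cv)//; apply: (@nondecreasing_cvgn_le _ (series (geometric a r))).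
    apply/nondecreasing_seqP => j; rewrite /series/= big_nat_recr//= lerDl.
    by rewrite mulr_ge0// exprn_ge0// ltW.
  by apply/cvg_ex; eexists; exact: cv.
move=> x /= nx n _; apply: contrapT => h; apply: nx.
exists n => // N /= nN EN; apply: h; exists N => //.
Qed.

End borel_cantelli_exp.

Lemma gin_points_sum (R : realType) (N M k : nat) (Omega : Type)
    (lambda : nat -> Omega -> plane R) (f : plane R -> R) (x : Omega) :
  \sum_(i < gin_card N M k) f (tnth (gin_points N M k lambda x) i) =
  \sum_(i <- gin_index N M k) f (lambda i x).
Proof.
rewrite [RHS]big_tnth; apply: eq_bigr => i _.
by rewrite /gin_points tnth_map.
Qed.

Section almost_sure_upper_bound.
Context (R : realType) (d : measure_display) (Omega : measurableType d)
  (P : probability Omega R) (k M : nat).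
Variable lambda : nat -> nat -> {RV P >-> plane R}.
Hypothesis hkM : (1 <= k <= M)%N.
Hypothesis hlambda : forall N : nat, (M <= N)%N ->
  is_Gin N M k (pushforward P (gin_points N M k (fun i => lambda N i))).

(** Only the law of each configuration enters, through the tail bound at each [N]; summability then
    gives an almost sure upper bound. Applied to [f] and to [- f], it controls both sides. *)
Lemma gin_eventually_le (g : plane R -> R) (B eps : R) : 0 < B -> 0 < eps ->
    measurable_fun setT g -> (forall z, `|g z| <= B) ->
  {ae P, forall x, \forall N \near \oo,
    \sum_(i <- gin_index N M k) g (lambda N i x) <
    \sum_(l < gin_card N M k) site_mean N M k l g + eps * (gin_card N M k)%:R}.
Proof.
move=> B0 eps0 mg gB.
have M0 : (0 < M)%N by case/andP: hkM => k1; exact: leq_trans.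
have MR0 : 0 < M%:R :> R by rewrite ltr0n.
have [delta delta0 tail] := gin_upper_tail hkM B0 eps0 mg gB.
(* The law is prescribed only for [M <= N]; earlier events are set to be empty. *)
pose E N : set Omega := if (M <= N)%N then [set x |
    \sum_(l < gin_card N M k) site_mean N M k l g + eps * (gin_card N M k)%:R <=
    \sum_(i <- gin_index N M k) g (lambda N i x)] else set0.
have mE N : measurable (E N).
  rewrite /E; case: ifP => // _; rewrite -[X in measurable X]setTI.
  apply: (@measurable_fun_ler _ _ _ setT (cst _) _ _ _ measurableT [set true]) => //.
  by apply: measurable_sum => i; exact: (measurableT_comp mg).
(* From [c >= N / M - 1] it follows that [expR (- delta c) <= expR delta * r ^+ N]. *)
pose r := expR (- (delta / M%:R)).
have r01 : 0 < r < 1.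
  by rewrite expR_gt0 expR_lt1 oppr_lt0 divr_gt0.
have PE N : (P (E N) <= (expR delta * r ^+ N)%:E)%E.
  rewrite /E; case: ifP => [MN|_]; last by rewrite measure0 lee_fin mulr_ge0 ?exprn_ge0 ?expR_ge0.
  have N0 : (0 < N)%N by exact: leq_trans MN.
  have := tail N _ N0 (hlambda MN) _.
  rewrite /pushforward preimage_setT probability_setT => /(_ erefl).
  have -> : gin_points N M k (fun i => lambda N i) @^-1`
     [set t | \sum_(l < gin_card N M k) site_mean N M k l g + eps * (gin_card N M k)%:R
        <= \sum_(i < gin_card N M k) g (tnth t i)] =
    [set x | \sum_(l < gin_card N M k) site_mean N M k l g + eps * (gin_card N M k)%:R
        <= \sum_(i <- gin_index N M k) g (lambda N i x)].
    by apply/seteqP; split => x /=; rewrite gin_points_sum.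
  move=> /le_trans; apply; rewrite lee_fin /r -expRM_natl -expRD ler_expR.
  have Mc : (N <= M * gin_card N M k + M)%N.
    rewrite gin_cardE//; have := divn_eq (N + M - k) M.
    have : ((N + M - k) %% M < M)%N by rewrite ltn_mod.
    by case/andP: hkM; nia.
  have {}Mc : N%:R <= M%:R * (gin_card N M k)%:R + M%:R :> R.
    by rewrite -natrM -natrD ler_nat.
  rewrite mulrN -lerBlDl; rewrite -(ler_pM2r MR0) mulrBl mulNr mulrAC.
  rewrite mulNr -[N%:R * _ * _]mulrA divfK ?gt_eqF//.
  by have := ler_wpM2l (ltW delta0) Mc; lra.
apply: filterS (borel_cantelli_geometric mE (expR_ge0 delta) r01 PE) => x.
move=> nE; near=> N.
have : ~ E N x by near: N; exact: nE.
have MN : (M <= N)%N by near: N; exact: nbhs_infty_ge.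
by rewrite /E MN /= => /negP; rewrite -ltNge.
Unshelve. all: by end_near. Qed.

End almost_sure_upper_bound.

Theorem theorem2p17 (R : realType) (d : measure_display)
    (Omega : measurableType d) (P : probability Omega R) (k M : nat)
    (lambda : nat -> nat -> {RV P >-> plane R})
    (hkM : (1 <= k <= M)%N)
    (hlambda : forall N : nat, (M <= N)%N ->
       is_Gin N M k (pushforward P (gin_points N M k (fun i => lambda N i))))
    (f : R * R -> R) (hfc : continuous f) (hfb : bounded_fun f) :
  {ae P, forall w,
    (fun N : nat => (gin_card N M k)%:R^-1 *
       \sum_(i <- gin_index N M k) f (lambda N i w)) @ \oo -->
    (pi * M%:R)^-1 *
      \int[@plane_lebesgue R]_(z in @unit_disk R)
        (f z * modulus z `^ (2 / M%:R - 2)) }.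
Proof.
have mf := continuous_measurable_plane hfc.
have [B B0 fB] : exists2 B : R, 0 < B & forall z, `|f z| <= B.
  have [B B0 hB] := ex_strict_bound_gt0 hfb.
  by exists B => // z; exact/ltW/hB.
(* The upper bound for [- f] is the lower bound for [f], since [site_mean] is odd in its function
   ([meanN]). *)
pose g : plane R -> R := fun z => - f z.
have mg : measurable_fun setT g by exact: measurable_funN.
have gB z : `|g z| <= B by rewrite normrN.
(* Deviations are restricted to the countable family [1 / (j + 1)], so that a single null set serves
   all of them. *)
have eps_gt0 j : 0 < j.+1%:R^-1 :> R by rewrite invr_gt0.
have up j := gin_eventually_le hkM hlambda B0 (eps_gt0 j) mf fB.
have dn j := gin_eventually_le hkM hlambda B0 (eps_gt0 j) mg gB.
have meanN N l : (0 < N)%N -> site_mean N M k l g = - site_mean N M k l f.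
  move=> N0; rewrite /site_mean -mulNr; congr (_ / _).
  rewrite -mulN1r -RintegralZl//; last exact: integrable_bounded_site mf fB.
  by apply: eq_Rintegral => z _; rewrite mulrN mulN1r.
have lim := cvg_mean_site hkM mf fB.
have M0 : (0 < M)%N by case/andP: hkM => k1; exact: leq_trans.
apply: filterS2 (ae_foralln up) (ae_foralln dn) => w upw dnw.
apply/cvgrPdist_lt => e e0.
have [j je] : exists j : nat, j.+1%:R^-1 < e / 2.
  exists (Num.trunc (e / 2)^-1); rewrite -[ltRHS]invrK ltf_pV2 ?posrE ?invr_gt0 ?divr_gt0//.
  exact: truncnS_gt.
near=> N.
have MN : (M <= N)%N by near: N; exact: nbhs_infty_ge.
have N0 : (0 < N)%N by exact: leq_trans MN.
have n0 : 0 < (gin_card N M k)%:R :> R by rewrite ltr0n gin_card_gt0.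
have h1 : `|(pi * M%:R)^-1 * \int[@plane_lebesgue R]_(z in @unit_disk R)
        (f z * modulus z `^ (2 / M%:R - 2)) -
   (gin_card N M k)%:R^-1 * \sum_(l < gin_card N M k) site_mean N M k l f| < e / 2.
  near: N; move/cvgrPdist_lt : lim => /(_ (e / 2)); apply; exact: divr_gt0.
have h2 : \sum_(i <- gin_index N M k) f (lambda N i w) <
    \sum_(l < gin_card N M k) site_mean N M k l f + j.+1%:R^-1 * (gin_card N M k)%:R.
  by near: N; exact: upw.
have h3 : \sum_(i <- gin_index N M k) g (lambda N i w) <
    \sum_(l < gin_card N M k) site_mean N M k l g + j.+1%:R^-1 * (gin_card N M k)%:R.
  by near: N; exact: dnw.
rewrite sumrN (eq_bigr (fun l : 'I_ _ => - site_mean N M k l f)) in h3; last first.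
  by move=> l _; exact: meanN.
rewrite sumrN in h3.
move: h1 h2 h3; set L := _ * \int[_]_(z in _) _.
set T := \sum_(l < _) _; set S := \sum_(i <- _) _; set n := _%:R in n0 *; set y := j.+1%:R^-1 in je * => h1 h2 h3.
(* The two one-sided bounds [h2] and [h3] together give [|T - S| < y * n]. *)
have h4 : `|n^-1 * T - n^-1 * S| < e / 2.
  rewrite -mulrBr normrM ger0_norm ?invr_ge0 ?(ltW n0)// mulrC ltr_pdivrMr//.
  apply: (@lt_trans _ _ (y * n)); last by rewrite ltr_pM2r.
  by rewrite ltr_norml; apply/andP; split; lra.
rewrite -(subrK (n^-1 * T) L) -addrA (le_lt_trans (ler_normD _ _))//.
by rewrite [ltRHS](splitr e) ltrD.
Unshelve. all: by end_near. Qed.
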